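(* Let $X$ be an irreducible $\operatorname{PGL}_n$-variety. The following are equivalent: (a) $\operatorname{RMaps}_{\operatorname{PGL}_n}(X,\operatorname{M}_n)$ is a central simple algebra of degree $n$. (b) There is a $\operatorname{PGL}_n$-equivariant dominant rational map $f\colon X\dashrightarrow Y$ for some irreducible $n$-variety $Y$. If these conditions hold, then the $\operatorname{PGL}_n$-action on $X$ has trivial stabilizers at points in general position, and $Y$ and $f$ can be chosen such that $f$ is in addition generically injective.
   Context: $k$ is an algebraically closed field of arbitrary characteristic and $n\ge 1$ is a fixed integer. $\operatorname{M}_n$ is the algebra of $n\times n$ matrices over $k$; $\operatorname{PGL}_n$ acts on $\operatorname{M}_n$ by conjugation and on $(\operatorname{M}_n)^m$ by simultaneous conjugation. $U_{m,n}\subseteq(\operatorname{M}_n)^m$ is the $\operatorname{PGL}_n$-stable Zariski open set of $m$-tuples that generate $\operatorname{M}_n$ as a (unital) $k$-algebra. An $n$-variety is a $\operatorname{PGL}_n$-stable subset of some $U_{m,n}$ that is Zariski closed in $U_{m,n}$. A $\operatorname{PGL}_n$-variety is an algebraic variety over $k$ with an algebraic $\operatorname{PGL}_n$-action. For an irreducible $\operatorname{PGL}_n$-variety $X$, $\operatorname{RMaps}_{\operatorname{PGL}_n}(X,\operatorname{M}_n)$ is the $k$-algebra (pointwise operations) of $\operatorname{PGL}_n$-equivariant rational maps $X\dashrightarrow\operatorname{M}_n$. A central simple algebra of degree $n$ is one of dimension $n^2$ over its center. Stabilizers are group-theoretic stabilizers; ''points in general position'' means all points of some dense open subset of $X$;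 ''generically injective'' means injective on some dense open subset of $X$. *)

(* Defs.v *)
From HB Require Import structures.
From mathcomp Require Import all_boot all_order all_algebra.
From mathcomp Require Import all_classical topology.
From mathcomp.multinomials Require mpoly.

Set Implicit Arguments.
Unset Strict Implicit.
Unset Printing Implicit Defensive.

Import GRing.Theory.

Local Open Scope classical_set_scope.
Local Open Scope ring_scope.
Local Open Scope quotient_scope.

(* Varieties are treated as spaces with functions: a topological space with a
   sheaf of algebras of k-valued functions such that the non-vanishing locus of
   a section is open and its inverse there is again a section.
   The sheaf is given by its germs: [regular_at x f] says that f restricts to a
   section on some neighbourhood of x, so the sections over an open set U are
   the functions regular at every point of U. Functions are total; the values
   of f away from x are irrelevant, by [regular_at_eq]. *)
HB.mixin Record isFunSpace (k : fieldType) X & Topological X := {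
  regular_at : X -> (X -> k) -> Prop;
  regular_at_near : forall x f,
    regular_at x f -> \forall y \near x, regular_at y f;
  regular_at_eq : forall x f g,
    (\forall y \near x, f y = g y) -> regular_at x f -> regular_at x g;
  regular_at_cst : forall x c, regular_at x (fun _ => c);
  regular_at_add : forall x f g,
    regular_at x f -> regular_at x g -> regular_at x (fun y => f y + g y);
  regular_at_mul : forall x f g,
    regular_at x f -> regular_at x g -> regular_at x (fun y => f y * g y);
  regular_at_neq0 : forall x f,
    regular_at x f -> f x != 0 -> \forall y \near x, f y != 0;
  regular_at_inv : forall x f,
    regular_at x f -> f x != 0 -> regular_at x (fun y => (f y)^-1)
}.

#[short(type="funSpaceType")]
HB.structure Definition FunSpace (k : fieldType) :=
  {X of isFunSpace k X & Topological X}.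

Arguments regular_at_near {k s x f}.
Arguments regular_at_eq {k s x f g}.
Arguments regular_at_add {k s x f g}.
Arguments regular_at_mul {k s x f g}.
Arguments regular_at_neq0 {k s x f}.
Arguments regular_at_inv {k s x f}.

Section Morphisms.
Variable k : fieldType.

Definition morphism_at (X Y : funSpaceType k) (phi : X -> Y) (x : X) : Prop :=
  {for x, continuous phi} /\
  (forall g : Y -> k, regular_at (phi x) g -> regular_at x (g \o phi)).

Definition morphism (X Y : funSpaceType k) (phi : X -> Y) : Prop :=
  forall x, morphism_at phi x.

Definition isomorphic (X Y : funSpaceType k) : Prop :=
  exists (phi : X -> Y) (psi : Y -> X),
    [/\ cancel phi psi, cancel psi phi, morphism phi & morphism psi].

End Morphisms.

Lemma near_all (T : topologicalType) (x : T) (P : T -> Prop) :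
  (forall y, P y) -> \forall y \near x, P y.
Proof. exact: nearW. Qed.

(* a finite dimensional vector space with its structure of affine space *)
Definition zariski (k : fieldType) (V : vectType k) : Type := V.

Section Zariski.
Import -(notations) mpoly.
Variables (k : fieldType) (V : vectType k).

HB.instance Definition _ := Choice.on (zariski V).

Definition polyfun (p : mpoly.mpoly (\dim {:V}) k) (v : V) : k :=
  meval (fun i => coord (vbasis {:V}) i v) p.

Definition zariski_open (U : set (zariski V)) : Prop :=
  forall v, U v -> exists2 p,
    polyfun p v != 0 & forall w, polyfun p w != 0 -> U w.

Let zariski_openT : zariski_open setT.
Proof. by move=> v _; exists 1 => //; rewrite /polyfun meval1 oner_eq0. Qed.

Let zariski_openI : setI_closed zariski_open.
Proof.
move=> U W oU oW v [/oU[p pv pU] /oW[q qv qW]]; exists (p * q).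
  by rewrite /polyfun mevalM mulf_neq0.
by move=> w; rewrite /polyfun mevalM mulf_eq0 negb_or => /andP[/pU ? /qW].
Qed.

Let zariski_open_bigU (I : Type) (U : I -> set (zariski V)) :
  (forall i, zariski_open (U i)) -> zariski_open (\bigcup_i U i).
Proof.
by move=> oU v [i _ /oU[p pv pU]]; exists p => // w /pU; exists i.
Qed.

HB.instance Definition _ := @isOpenTopological.Build (zariski V)
  zariski_open zariski_openT zariski_openI zariski_open_bigU.


Lemma polyfun_near (v : zariski V) p :
  polyfun p v != 0 -> \forall w \near v, polyfun p w != 0.
Proof.
move=> pv; apply: (@open_nbhs_nbhs _ v [set w | polyfun p w != 0]); split=> //.
suff: zariski_open [set w | polyfun p w != 0] by [].
by move=> w pw; exists p.
Qed.

Lemma zariski_nbhsP (v : zariski V) (U : set (zariski V)) :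
  nbhs v U -> exists2 p, polyfun p v != 0 & forall w, polyfun p w != 0 -> U w.
Proof.
rewrite nbhsE => -[O [oO Ov] OU]; have /(_ v Ov)[p pv pO] : zariski_open O by [].
by exists p => // w /pO/OU.
Qed.

(* locally a quotient of polynomial functions *)
Definition zariski_regular_at (v : zariski V) (f : zariski V -> k) : Prop :=
  exists p q, polyfun q v != 0 /\
    \forall w \near v, f w = polyfun p w / polyfun q w.

Let regularn v f : zariski_regular_at v f ->
  \forall w \near v, zariski_regular_at w f.
Proof.
move=> [p [q [qv fpq]]]; near=> w; exists p, q; split; near: w.
  exact: polyfun_near.
exact: (near_join fpq).
Unshelve. all: by end_near. Qed.

Let regulare v f g : (\forall w \near v, f w = g w) ->
  zariski_regular_at v f -> zariski_regular_at v g.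
Proof.
move=> fg [p [q [qv fpq]]]; exists p, q; split=> //.
by apply: filterS2 fg fpq => w ->.
Qed.

Let regularc v c : zariski_regular_at v (fun _ => c).
Proof.
exists (mpolyC _ c), 1; rewrite /polyfun meval1 oner_eq0; split=> //.
by apply: near_all => w; rewrite mevalC meval1 divr1.
Qed.

Let regulara v f g : zariski_regular_at v f -> zariski_regular_at v g ->
  zariski_regular_at v (fun w => f w + g w).
Proof.
move=> [p [q [qv fE]]] [r [s [sv gE]]]; exists (p * s + r * q), (q * s).
split; first by rewrite /polyfun mevalM mulf_neq0.
apply: filterS2 (filterI fE gE) (filterI (polyfun_near qv) (polyfun_near sv)).
move=> w [-> ->] [qw sw]; rewrite addf_div //.
by rewrite /polyfun mevalD !mevalM.
Qed.

Let regularm v f g : zariski_regular_at v f -> zariski_regular_at v g ->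
  zariski_regular_at v (fun w => f w * g w).
Proof.
move=> [p [q [qv fE]]] [r [s [sv gE]]]; exists (p * r), (q * s).
split; first by rewrite /polyfun mevalM mulf_neq0.
apply: filterS2 fE gE => w -> ->.
by rewrite mulf_div /polyfun !mevalM.
Qed.

Let regularn0 v f : zariski_regular_at v f -> f v != 0 ->
  \forall w \near v, f w != 0.
Proof.
move=> [p [q [qv fE]]]; rewrite (nbhs_singleton fE) mulf_eq0 negb_or.
move=> /andP[pv _].
apply: filterS3 fE (polyfun_near pv) (polyfun_near qv) => w -> pw qw.
by rewrite mulf_neq0 // invr_eq0.
Qed.

Let regularV v f : zariski_regular_at v f -> f v != 0 ->
  zariski_regular_at v (fun w => (f w)^-1).
Proof.
move=> [p [q [qv fE]]]; rewrite (nbhs_singleton fE) mulf_eq0 negb_or.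
move=> /andP[pv _]; exists q, p; split=> //.
by apply: filterS fE => w ->; rewrite invf_div.
Qed.

HB.instance Definition _ := @isFunSpace.Build k (zariski V) zariski_regular_at
  regularn regulare regularc regulara regularm regularn0 regularV.

Lemma linear_regular (L : {linear V -> k^o}) (v : zariski V) :
  regular_at v (L : zariski V -> k).
Proof.
exists (\sum_(i < \dim {:V}) L (vbasis {:V})`_i *: mpolyX k (mnm1 i)), 1.
rewrite /polyfun meval1 oner_eq0; split=> //.
apply: near_all => w; rewrite meval1 divr1.
have -> : L w = L (\sum_i coord (vbasis {:V}) i w *: (vbasis {:V})`_i).
  by rewrite -coord_vbasis // memvf.
rewrite linear_sum [in RHS]raddf_sum; apply: eq_bigr => i _.
by rewrite linearZ /= mevalZ mevalXU mulrC.
Qed.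

End Zariski.

Section MorphismTheory.
Import -(notations) mpoly.
Variables (k : fieldType) (X : funSpaceType k).

Lemma regular_at_sum (I : Type) (r : seq I) (P : pred I) (F : I -> X -> k) x :
  (forall i, regular_at x (F i)) ->
  regular_at x (fun y => \sum_(i <- r | P i) F i y).
Proof.
move=> rF; elim: r => [|i r IHr].
  apply: (regular_at_eq _ (regular_at_cst x (0 : k))).
  by apply: near_all => y; rewrite big_nil.
have rS : regular_at x (fun y => (P i)%:R * F i y + \sum_(j <- r | P j) F j y).
  by apply/regular_at_add/IHr/regular_at_mul/rF/regular_at_cst.
apply: (regular_at_eq _ rS); apply: near_all => y; rewrite big_cons.
by case: (P i); rewrite ?mul1r // mul0r add0r.
Qed.

Lemma regular_at_prod (I : Type) (r : seq I) (P : pred I) (F : I -> X -> k) x :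
  (forall i, regular_at x (F i)) ->
  regular_at x (fun y => \prod_(i <- r | P i) F i y).
Proof.
move=> rF; elim: r => [|i r IHr].
  apply: (regular_at_eq _ (regular_at_cst x (1 : k))).
  by apply: near_all => y; rewrite big_nil.
case Pi: (P i); last first.
  by apply: (regular_at_eq _ IHr); apply: near_all => y; rewrite big_cons Pi.
apply: (regular_at_eq _ (regular_at_mul (rF i) IHr)).
by apply: near_all => y; rewrite big_cons Pi.
Qed.

Lemma morphism_zariskiP (V : vectType k) (phi : X -> zariski V) x :
  morphism_at phi x <->
  (forall L : {linear V -> k^o}, regular_at x (fun y => L (phi y) : k)).
Proof.
split=> [[_ rphi] L|rphi]; first exact: rphi (linear_regular L (phi x)).
have rpoly p : regular_at x (polyfun p \o phi).
  have -> : polyfun p \o phi = fun y => \sum_(m <- msupp p) mcoeff m p *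
      \prod_i (\prod_(j < mpoly.fun_of_multinom m i)
        coord (vbasis {:V}) i (phi y)).
    apply/funext => y; rewrite /= /polyfun mevalE; apply: eq_bigr => m _.
    by congr (_ * _); apply: eq_bigr => i _; rewrite prodr_const card_ord.
  apply: regular_at_sum => m; apply: regular_at_mul; first exact: regular_at_cst.
  by apply: regular_at_prod => i; apply: regular_at_prod => j; exact: rphi.
split.
  move=> U /zariski_nbhsP[p pU Up].
  by apply: filterS (regular_at_neq0 (rpoly p) pU) => y /Up.
move=> g [p [q [qx gE]]].
have rpq : regular_at x (fun y => polyfun p (phi y) / polyfun q (phi y)).
  exact: (regular_at_mul (rpoly p) (regular_at_inv (rpoly q) qx)).
apply: (regular_at_eq _ rpq).
move: gE => /zariski_nbhsP[r rU Ur].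
by apply: filterS (regular_at_neq0 (rpoly r) rU) => y /Ur.
Qed.

Lemma morphism_matrixP m n (phi : X -> zariski 'M[k]_(m, n)) x :
  morphism_at phi x <->
  (forall i j, regular_at x (fun y => (phi y : 'M[k]_(m, n)) i j)).
Proof.
rewrite morphism_zariskiP; split=> [rphi i j|rphi L].
  have lin : linear (fun A : 'M[k]_(m, n) => A i j : k^o).
    by move=> a A B; rewrite !mxE.
  pose M := GRing.isLinear.Build _ _ _ _ (fun A : 'M[k]_(m, n) => A i j : k^o) lin.
  pose L : {linear 'M[k]_(m, n) -> k^o} := HB.pack
    (fun A : 'M[k]_(m, n) => A i j : k^o) M.
  exact: (rphi L).
have rS : regular_at x (fun y =>
    \sum_i \sum_j (phi y : 'M[k]_(m, n)) i j * L (delta_mx i j)).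
  apply: regular_at_sum => i; apply: regular_at_sum => j.
  exact/regular_at_mul/regular_at_cst.
apply: (regular_at_eq _ rS); apply: near_all => y.
rewrite [in RHS](matrix_sum_delta (phi y)) linear_sum; apply: eq_bigr => i _.
by rewrite linear_sum; apply: eq_bigr => j _; rewrite linearZ.
Qed.

End MorphismTheory.

(* the structure induced on a subset *)
Section Subspace.
Variables (k : fieldType) (X : funSpaceType k) (A : set X).

Definition sub_regular_at (x : A) (f : A -> k) : Prop :=
  exists2 g : X -> k, regular_at (set_val x) g &
    \forall y \near x, f y = g (set_val y).

Let near_val (x : A) (P : set X) :
  (\forall y \near set_val x, P y) -> \forall y \near x, P (set_val y).
Proof. exact: (@initial_continuous _ _ (set_val : A -> X)). Qed.

Let regularn x f : sub_regular_at x f -> \forall y \near x, sub_regular_at y f.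
Proof.
move=> [g rg fg].
have := @near_val x (fun z => regular_at z g) (regular_at_near rg).
by apply: filterS2 (near_join fg) => y fgy rgy; exists g.
Qed.

Let regulare x f g : (\forall y \near x, f y = g y) ->
  sub_regular_at x f -> sub_regular_at x g.
Proof.
by move=> fg [h rh fh]; exists h => //; apply: filterS2 fg fh => y ->.
Qed.

Let regularc x c : sub_regular_at x (fun _ => c).
Proof. by exists (fun _ => c); [exact: regular_at_cst|exact: near_all]. Qed.

Let regulara x f g : sub_regular_at x f -> sub_regular_at x g ->
  sub_regular_at x (fun y => f y + g y).
Proof.
move=> [f' rf fE] [g' rg gE]; exists (fun y => f' y + g' y).
  exact: regular_at_add.
by apply: filterS2 fE gE => y -> ->.
Qed.

Let regularm x f g : sub_regular_at x f -> sub_regular_at x g ->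
  sub_regular_at x (fun y => f y * g y).
Proof.
move=> [f' rf fE] [g' rg gE]; exists (fun y => f' y * g' y).
  exact: regular_at_mul.
by apply: filterS2 fE gE => y -> ->.
Qed.

Let regularn0 x f : sub_regular_at x f -> f x != 0 ->
  \forall y \near x, f y != 0.
Proof.
move=> [g rg fE]; rewrite (nbhs_singleton fE) => gx.
have := @near_val x (fun z => g z != 0) (regular_at_neq0 rg gx).
by apply: filterS2 fE => y ->.
Qed.

Let regularV x f : sub_regular_at x f -> f x != 0 ->
  sub_regular_at x (fun y => (f y)^-1).
Proof.
move=> [g rg fE]; rewrite (nbhs_singleton fE) => gx.
exists (fun y => (g y)^-1); first exact: regular_at_inv.
by apply: filterS fE => y ->.
Qed.

HB.instance Definition _ := @isFunSpace.Build k (set_type A) sub_regular_at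
  regularn regulare regularc regulara regularm regularn0 regularV.

End Subspace.

(* The product of two spaces with functions. The open sets
   {(x, y) in U x V | \sum_i f_i x * g_i y != 0}, with f_i regular on U and g_i
   regular on V, form a basis of its topology, and its regular functions are
   locally quotients of such sums. *)
Record tensor (X Y K : Type) := Tensor {
  tensor_index : finType;
  tensor_left : tensor_index -> X -> K;
  tensor_right : tensor_index -> Y -> K
}.

Definition zprod (k : fieldType) (X Y : funSpaceType k) : Type := (X * Y)%type.

Section Product.
Variables (k : fieldType) (X Y : funSpaceType k).

HB.instance Definition _ := Choice.on (zprod X Y).

Definition teval (t : tensor X Y k) (z : zprod X Y) : k :=
  \sum_i tensor_left (t := t) i z.1 * tensor_right (t := t) i z.2.

Definition tregular (t : tensor X Y k) (z : zprod X Y) : Prop :=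
  forall i, regular_at z.1 (tensor_left (t := t) i) /\
            regular_at z.2 (tensor_right (t := t) i).

Definition zprod_open (W : set (zprod X Y)) : Prop :=
  forall z, W z -> exists (t : tensor X Y k) (U : set X) (V : set Y),
    [/\ nbhs z.1 U, nbhs z.2 V, tregular t z, teval t z != 0 &
        forall z' : X * Y, U z'.1 -> V z'.2 -> teval t z' != 0 -> W z'].

Let tcst (c : k) : tensor X Y k :=
  @Tensor X Y k unit (fun _ _ => c) (fun _ _ => 1).
Let tadd (s t : tensor X Y k) : tensor X Y k :=
  @Tensor X Y k (tensor_index s + tensor_index t)%type
    (fun i => match i with inl i => tensor_left (t := s) i
                         | inr i => tensor_left (t := t) i end)
    (fun i => match i with inl i => tensor_right (t := s) i
                         | inr i => tensor_right (t := t) i end).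
Let tmul (s t : tensor X Y k) : tensor X Y k :=
  @Tensor X Y k (tensor_index s * tensor_index t)%type
    (fun i x => tensor_left (t := s) i.1 x * tensor_left (t := t) i.2 x)
    (fun i y => tensor_right (t := s) i.1 y * tensor_right (t := t) i.2 y).

Let teval_cst c z : teval (tcst c) z = c.
Proof. by rewrite /teval /= big_const card_unit /= mulr1 addr0. Qed.
Let teval_add s t z : teval (tadd s t) z = teval s z + teval t z.
Proof. by rewrite /teval big_sumType. Qed.
Let teval_mul s t z : teval (tmul s t) z = teval s z * teval t z.
Proof.
rewrite /teval big_distrl /=.
under [RHS]eq_bigr => i _ do rewrite big_distrr /=.
rewrite pair_big; apply: eq_bigr => -[i j] _ /=.
by rewrite mulrACA.
Qed.
Let treg_cst c z : tregular (tcst c) z.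
Proof. by move=> i; split; exact: regular_at_cst. Qed.
Let treg_add s t z : tregular s z -> tregular t z -> tregular (tadd s t) z.
Proof. by move=> rs rt [i|i]; [exact: rs|exact: rt]. Qed.
Let treg_mul s t z : tregular s z -> tregular t z -> tregular (tmul s t) z.
Proof.
move=> rs rt [i j]; have [? ?] := rs i; have [? ?] := rt j.
by split; exact: regular_at_mul.
Qed.

Let zprod_openT : zprod_open setT.
Proof.
move=> z _; exists (tcst 1), setT, setT.
by split; rewrite ?teval_cst ?oner_eq0 //; exact: filterT.
Qed.

Let zprod_openI : setI_closed zprod_open.
Proof.
move=> W W' oW oW' z [/oW[t [U [V [zU zV rt tz tW]]]]].
move=> /oW'[t' [U' [V' [zU' zV' rt' tz' tW']]]].
exists (tmul t t'), (U `&` U'), (V `&` V'); split; try exact: filterI.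
- exact: treg_mul.
- by rewrite teval_mul mulf_neq0.
- move=> z' [? ?] [? ?]; rewrite teval_mul mulf_eq0 negb_or => /andP[? ?].
  by split; [exact: tW|exact: tW'].
Qed.

Let zprod_open_bigU (I : Type) (W : I -> set (zprod X Y)) :
  (forall i, zprod_open (W i)) -> zprod_open (\bigcup_i W i).
Proof.
move=> oW z [i _ /oW[t [U [V [zU zV rt tz tW]]]]].
by exists t, U, V; split=> // z' ? ? ?; exists i => //; exact: tW.
Qed.

HB.instance Definition _ := @isOpenTopological.Build (zprod X Y)
  zprod_open zprod_openT zprod_openI zprod_open_bigU.

Lemma near_zprod (z : zprod X Y) (U : set X) (V : set Y) :
  nbhs z.1 U -> nbhs z.2 V -> \forall z' \near z, U z'.1 /\ V z'.2.
Proof.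
move=> zU zV.
have : open_nbhs z [set z' : zprod X Y | U° z'.1 /\ V° z'.2].
  split; last by [].
  suff : zprod_open [set z' : zprod X Y | U° z'.1 /\ V° z'.2] by [].
  move=> w [wU wV]; exists (tcst 1), U°, V°; rewrite teval_cst oner_eq0.
  by split=> //; exact: nbhs_interior.
move=> /open_nbhs_nbhs H; apply: filterS H => z' [z'U z'V].
by split; exact: nbhs_singleton.
Qed.

Lemma tregular_near (z : zprod X Y) (t : tensor X Y k) :
  tregular t z -> \forall z' \near z, tregular t z'.
Proof.
move=> rt.
have rl : \forall x \near z.1, forall i, regular_at x (tensor_left (t := t) i).
  by apply: filter_forall => i; exact: (regular_at_near (rt i).1).
have rr : \forall y \near z.2, forall i, regular_at y (tensor_right (t := t) i).
  by apply: filter_forall => i; exact: (regular_at_near (rt i).2).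
by apply: filterS (near_zprod rl rr) => z' [rl' rr'] i; split.
Qed.

Lemma teval_near (z : zprod X Y) (t : tensor X Y k) :
  tregular t z -> teval t z != 0 -> \forall z' \near z, teval t z' != 0.
Proof.
move=> rt tz.
pose W := [set z' : zprod X Y | tregular t z' /\ teval t z' != 0].
have oW : zprod_open W.
  move=> w [rw tw].
  exists t, [set x | forall i, regular_at x (tensor_left (t := t) i)],
    [set y | forall i, regular_at y (tensor_right (t := t) i)]; split=> //.
  - by apply: filter_forall => i; exact: (regular_at_near (rw i).1).
  - by apply: filter_forall => i; exact: (regular_at_near (rw i).2).
have : nbhs z W by exact: open_nbhs_nbhs.
by apply: filterS => z' [].
Qed.

Definition zprod_regular_at (z : zprod X Y) (h : zprod X Y -> k) : Prop :=
  exists s t : tensor X Y k, [/\ tregular s z, tregular t z, teval t z != 0 &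
    \forall z' \near z, h z' = teval s z' / teval t z'].

Let regularn z f : zprod_regular_at z f ->
  \forall z' \near z, zprod_regular_at z' f.
Proof.
move=> [s [t [rs rt tz fE]]].
apply: filterS2 (filterI (tregular_near rs) (tregular_near rt))
  (filterI (teval_near rt tz) (near_join fE)).
by move=> z' [? ?] [? ?]; exists s, t.
Qed.

Let regulare z f g : (\forall z' \near z, f z' = g z') ->
  zprod_regular_at z f -> zprod_regular_at z g.
Proof.
move=> fg [s [t [rs rt tz fE]]]; exists s, t; split=> //.
by apply: filterS2 fg fE => z' ->.
Qed.

Let regularc z c : zprod_regular_at z (fun _ => c).
Proof.
exists (tcst c), (tcst 1); rewrite teval_cst oner_eq0; split=> //.
by apply: near_all => z'; rewrite !teval_cst divr1.
Qed.

Let regulara z f g : zprod_regular_at z f -> zprod_regular_at z g ->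
  zprod_regular_at z (fun y => f y + g y).
Proof.
move=> [s [t [rs rt tz fE]]] [s' [t' [rs' rt' tz' gE]]].
exists (tadd (tmul s t') (tmul s' t)), (tmul t t').
rewrite teval_mul mulf_neq0 //; split=> //.
- by apply: treg_add; exact: treg_mul.
- exact: treg_mul.
apply: filterS2 (filterI fE gE) (filterI (teval_near rt tz) (teval_near rt' tz')).
by move=> w [-> ->] [tw tw']; rewrite addf_div // teval_add !teval_mul.
Qed.

Let regularm z f g : zprod_regular_at z f -> zprod_regular_at z g ->
  zprod_regular_at z (fun y => f y * g y).
Proof.
move=> [s [t [rs rt tz fE]]] [s' [t' [rs' rt' tz' gE]]].
exists (tmul s s'), (tmul t t').
rewrite teval_mul mulf_neq0 //; split; try exact: treg_mul; first by [].
by apply: filterS2 fE gE => w -> ->; rewrite mulf_div !teval_mul.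
Qed.

Let regularn0 z f : zprod_regular_at z f -> f z != 0 ->
  \forall z' \near z, f z' != 0.
Proof.
move=> [s [t [rs rt tz fE]]]; rewrite (nbhs_singleton fE) mulf_eq0 negb_or.
move=> /andP[sz _].
apply: filterS3 fE (teval_near rs sz) (teval_near rt tz) => w -> sw tw.
by rewrite mulf_neq0 // invr_eq0.
Qed.

Let regularV z f : zprod_regular_at z f -> f z != 0 ->
  zprod_regular_at z (fun y => (f y)^-1).
Proof.
move=> [s [t [rs rt tz fE]]]; rewrite (nbhs_singleton fE) mulf_eq0 negb_or.
move=> /andP[sz _]; exists t, s; split=> //.
by apply: filterS fE => w ->; rewrite invf_div.
Qed.

HB.instance Definition _ := @isFunSpace.Build k (zprod X Y) zprod_regular_at
  regularn regulare regularc regulara regularm regularn0 regularV.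

End Product.

Section Varieties.
Variable k : fieldType.

Definition affine_variety (X : funSpaceType k) : Prop :=
  exists (N : nat) (Z : set (zariski 'rV[k]_N)), closed Z /\ isomorphic X Z.

Definition variety (X : funSpaceType k) : Prop :=
  (exists (I : finType) (U : I -> set X),
     (forall i, open (U i) /\ affine_variety (U i)) /\ \bigcup_i U i = setT) /\
  closed [set z : zprod X X | z.1 = z.2].

End Varieties.

Definition irreducible (T : topologicalType) : Prop :=
  [set: T] !=set0 /\
  forall A B : set T, closed A -> closed B -> A `|` B = setT ->
    A = setT \/ B = setT.

(* A rational map, given by a morphism defined on a dense open subset; [rfun]
   takes arbitrary values outside [rdom]. Two such data represent the same
   rational map when [rmap_eq] holds. *)
Record rmap (k : fieldType) (X Y : funSpaceType k) := RMap {
  rdom : set X;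
  rfun :> X -> Y;
  rdom_open : open rdom;
  rdom_dense : dense rdom;
  rfun_morphism : forall x, rdom x -> morphism_at rfun x
}.

Section RationalMaps.
Variables (k : fieldType) (X Y : funSpaceType k).

Definition rmap_eq (phi psi : rmap X Y) : Prop :=
  exists W : set X, [/\ open W, dense W, W `<=` rdom phi `&` rdom psi &
    forall x, W x -> phi x = psi x].

Definition dominant (phi : rmap X Y) : Prop := dense (phi @` rdom phi).

Definition generically_injective (phi : rmap X Y) : Prop :=
  exists W : set X, [/\ open W, dense W, W `<=` rdom phi &
    forall x y, W x -> W y -> phi x = phi y -> x = y].

End RationalMaps.

Section PGL.
Variables (k : fieldType) (n : nat).

Definition GL : set (zariski 'M[k]_n) :=
  [set A : 'M[k]_n | A \in unitmx].

Definition gl_mx (A : GL) : 'M[k]_n := set_val A.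

Lemma gl_mx_unit (A : GL) : gl_mx A \in unitmx.
Proof. exact: set_mem (valP A). Qed.

Definition to_gl (A : 'M[k]_n) (uA : A \in unitmx) : GL :=
  exist (fun A => A \in GL) A (mem_set uA).

Definition gl_one : GL := to_gl (unitmx1 k n).
Definition gl_inv (A : GL) : GL :=
  @to_gl (invmx (gl_mx A)) (etrans (unitmx_inv _) (gl_mx_unit A)).
Lemma gl_mul_unit (A B : GL) : gl_mx A *m gl_mx B \in unitmx.
Proof. by rewrite unitmx_mul !gl_mx_unit. Qed.
Definition gl_mul (A B : GL) : GL := to_gl (gl_mul_unit A B).

Lemma gl_mxM A B : gl_mx (gl_mul A B) = gl_mx A *m gl_mx B.
Proof. by []. Qed.

Definition proportional (A B : GL) : bool :=
  `[< exists2 c : k, c != 0 & gl_mx A = c *: gl_mx B >].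

Lemma proportional_refl : reflexive proportional.
Proof. by move=> A; apply/asboolP; exists 1; rewrite ?oner_eq0 ?scale1r. Qed.

Lemma proportional_sym : symmetric proportional.
Proof.
suff imp A B : proportional A B -> proportional B A.
  by move=> A B; apply/idP/idP; exact: imp.
move=> /asboolP[c c0 E]; apply/asboolP; exists c^-1; rewrite ?invr_eq0 //.
by rewrite E scalerA mulVf // scale1r.
Qed.

Lemma proportional_trans : transitive proportional.
Proof.
move=> B A C /asboolP[c c0 E] /asboolP[d d0 F]; apply/asboolP.
by exists (c * d); rewrite ?mulf_neq0 // E F scalerA.
Qed.

Canonical proportional_equiv := EquivRel proportional
  proportional_refl proportional_sym proportional_trans.

Definition PGL : Type := quotient_topology {eq_quot proportional}.

HB.instance Definition _ := Topological.copy PGL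
  (quotient_topology {eq_quot proportional}).

Definition pgl (A : GL) : PGL := \pi_({eq_quot proportional}) A.
Definition pgl_repr (g : PGL) : GL := repr (g : {eq_quot proportional}).

Lemma pgl_reprK g : pgl (pgl_repr g) = g.
Proof. exact: reprK. Qed.

Lemma eq_pgl A B : pgl A = pgl B <-> proportional A B.
Proof. by split=> [/eqmodP|AB]; last exact/eqmodP. Qed.

Definition pgl_mul (g h : PGL) : PGL := pgl (gl_mul (pgl_repr g) (pgl_repr h)).
Definition pgl_inv (g : PGL) : PGL := pgl (gl_inv (pgl_repr g)).

Lemma pgl_mulE A B : pgl_mul (pgl A) (pgl B) = pgl (gl_mul A B).
Proof.
have /eq_pgl/asboolP[c c0 E] := pgl_reprK (pgl A).
have /eq_pgl/asboolP[d d0 F] := pgl_reprK (pgl B).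
apply/eq_pgl/asboolP; exists (c * d); first exact: mulf_neq0.
by rewrite !gl_mxM E F -scalemxAl -scalemxAr scalerA.
Qed.

Let pgl_mulA : associative pgl_mul.
Proof.
move=> f g h; rewrite -(pgl_reprK f) -(pgl_reprK g) -(pgl_reprK h) !pgl_mulE.
by congr pgl; apply/val_inj; rewrite /= mulmxA.
Qed.

Let pgl_mul1 : left_id (pgl gl_one) pgl_mul.
Proof.
move=> g; rewrite -(pgl_reprK g) pgl_mulE.
by congr pgl; apply/val_inj; rewrite /= mul1mx.
Qed.

Let pgl_1mul : right_id (pgl gl_one) pgl_mul.
Proof.
move=> g; rewrite -(pgl_reprK g) pgl_mulE.
by congr pgl; apply/val_inj; rewrite /= mulmx1.
Qed.

Let pgl_mulV : left_inverse (pgl gl_one) pgl_inv pgl_mul.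
Proof.
move=> g; rewrite -{2}(pgl_reprK g) pgl_mulE.
by congr pgl; apply/val_inj; rewrite /= mulVmx // gl_mx_unit.
Qed.

Let pgl_Vmul : right_inverse (pgl gl_one) pgl_inv pgl_mul.
Proof.
move=> g; rewrite -{1}(pgl_reprK g) pgl_mulE.
by congr pgl; apply/val_inj; rewrite /= mulmxV // gl_mx_unit.
Qed.

HB.instance Definition _ := isGroup.Build PGL
  pgl_mulA pgl_mul1 pgl_1mul pgl_mulV pgl_Vmul.

(* f is a section over U when f \o pgl is a section over the preimage of U *)
Definition pgl_regular_at (g : PGL) (f : PGL -> k) : Prop :=
  \forall h \near g, forall A : GL, pgl A = h -> regular_at A (f \o pgl).

Let near_pgl (A : GL) (P : set PGL) :
  (\forall h \near pgl A, P h) -> \forall B \near A, P (pgl B).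
Proof. exact: (@pi_continuous _ {eq_quot proportional}). Qed.

Let regularn g f : pgl_regular_at g f -> \forall h \near g, pgl_regular_at h f.
Proof. exact: near_join. Qed.

Let regulare g f f' : (\forall h \near g, f h = f' h) ->
  pgl_regular_at g f -> pgl_regular_at g f'.
Proof.
move=> ff' rf; apply: filterS2 (near_join ff') rf => h ff'h rfh A Ah.
have rfA := rfh A Ah; apply: (regular_at_eq _ rfA).
by rewrite -Ah in ff'h; exact: near_pgl ff'h.
Qed.

Let regularc g c : pgl_regular_at g (fun _ => c).
Proof. by apply: near_all => h A _; exact: regular_at_cst. Qed.

Let regulara g f f' : pgl_regular_at g f -> pgl_regular_at g f' ->
  pgl_regular_at g (fun h => f h + f' h).
Proof.
move=> rf rf'; apply: filterS2 rf rf' => h rf rf' A Ah.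
by apply: regular_at_add; [exact: rf|exact: rf'].
Qed.

Let regularm g f f' : pgl_regular_at g f -> pgl_regular_at g f' ->
  pgl_regular_at g (fun h => f h * f' h).
Proof.
move=> rf rf'; apply: filterS2 rf rf' => h rf rf' A Ah.
by apply: regular_at_mul; [exact: rf|exact: rf'].
Qed.

Let regularn0 g f : pgl_regular_at g f -> f g != 0 ->
  \forall h \near g, f h != 0.
Proof.
move=> rg fg.
have : nbhs g [set h | forall A, pgl A = h -> regular_at A (f \o @pgl)] by [].
rewrite nbhsE => -[O [oO Og] rf].
have oP : open (O `&` [set h | f h != 0]).
  suff : open (@pgl @^-1` (O `&` [set h | f h != 0])) by [].
  rewrite openE => A [OA fA].
  have : \forall B \near A, O (pgl B).
    by apply: near_pgl; exact: open_nbhs_nbhs.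
  have := regular_at_neq0 (rf _ OA A erefl) fA.
  by apply: filterS2 => B ? ?; split.
have : nbhs g (O `&` [set h | f h != 0]) by exact: open_nbhs_nbhs.
by apply: filterS => h [].
Qed.

Let regularV g f : pgl_regular_at g f -> f g != 0 ->
  pgl_regular_at g (fun h => (f h)^-1).
Proof.
move=> rf fg; apply: filterS2 rf (regularn0 rf fg) => h rf fh A Ah.
by apply: regular_at_inv; [exact: rf|rewrite /= Ah].
Qed.

HB.instance Definition _ := @isFunSpace.Build k PGL pgl_regular_at
  regularn regulare regularc regulara regularm regularn0 regularV.

Definition pgl_conj (g : PGL) (M : 'M[k]_n) : 'M[k]_n :=
  gl_mx (pgl_repr g) *m M *m invmx (gl_mx (pgl_repr g)).

Lemma pgl_conjE A M : pgl_conj (pgl A) M = gl_mx A *m M *m invmx (gl_mx A).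
Proof.
have /eq_pgl/asboolP[c c0 E] := pgl_reprK (pgl A).
rewrite /pgl_conj E invmxZ -?E ?gl_mx_unit // {1}E.
by rewrite -!scalemxAl -scalemxAr scalerA mulfV // scale1r.
Qed.

End PGL.

Section PGLVarieties.
Variables (k : fieldType) (n : nat).

Record PGLvariety := PGLVariety {
  gvar :> funSpaceType k;
  gvar_variety : variety gvar;
  gact : PGL k n -> gvar -> gvar;
  gact1 : forall x, gact 1%g x = x;
  gactM : forall g h x, gact (g * h)%g x = gact g (gact h x);
  gact_morphism :
    morphism (fun z : zprod (PGL k n) gvar => gact z.1 z.2)
}.

(* equivariance of a partially defined map: g f(x) = f(g x) whenever f is
   defined at x and at g x *)
Definition equivariant (X : PGLvariety) (T : Type) (act : PGL k n -> T -> T)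
    (D : set X) (f : X -> T) : Prop :=
  forall g x, D x -> D (gact g x) -> f (gact g x) = act g (f x).

Definition generically_free (X : PGLvariety) : Prop :=
  exists W : set X, [/\ open W, dense W &
    forall x, W x -> forall g, gact g x = x -> g = 1%g].

Definition subalgebra (S : set 'M[k]_n) : Prop :=
  [/\ S 1%:M, forall a A B, S A -> S B -> S (a *: A + B) &
      forall A B, S A -> S B -> S (A *m B)].

Definition generating (m : nat) : set (zariski {ffun 'I_m -> 'M[k]_n}) :=
  [set a : {ffun 'I_m -> 'M[k]_n} |
    forall S, subalgebra S -> (forall i, S (a i)) -> S = setT].

Definition tuple_conj (m : nat) (g : PGL k n) (a : {ffun 'I_m -> 'M[k]_n}) :
  {ffun 'I_m -> 'M[k]_n} := [ffun i => pgl_conj g (a i)].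

Definition n_variety (m : nat) (Y : set (zariski {ffun 'I_m -> 'M[k]_n})) :=
  (exists2 C, closed C & Y = @generating m `&` C) /\
  (forall g y, Y y -> Y (tuple_conj g y)).

End PGLVarieties.

Section RMaps.
Variables (k : fieldType) (n : nat) (X : PGLvariety k n).

Record eqrmap := EqRMap {
  eqrmap_rmap :> rmap X (zariski 'M[k]_n);
  eqrmap_equivariant :
    equivariant (@pgl_conj k n) (rdom eqrmap_rmap) eqrmap_rmap
}.

HB.instance Definition _ := gen_eqMixin eqrmap.
HB.instance Definition _ := gen_choiceMixin eqrmap.

Definition eqrmap_eq (phi psi : eqrmap) : bool := `[< rmap_eq phi psi >].

Let dense_open_T : dense [set: X].
Proof. by move=> O [x Ox] _; exists x. Qed.

Let eqrmap_eqW (phi psi : eqrmap) :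
  (forall x, phi x = psi x) -> rmap_eq phi psi.
Proof.
move=> E; exists (rdom phi `&` rdom psi); split=> //.
  by apply: openI; exact: rdom_open.
by apply: denseI; [exact: rdom_open|exact: rdom_dense|exact: rdom_dense].
Qed.

Let eqrmap_eq_refl : reflexive eqrmap_eq.
Proof. by move=> phi; apply/asboolP/eqrmap_eqW. Qed.

Let eqrmap_eq_sym : symmetric eqrmap_eq.
Proof.
suff imp phi psi : eqrmap_eq phi psi -> eqrmap_eq psi phi.
  by move=> phi psi; apply/idP/idP; exact: imp.
move=> /asboolP[W [oW dW sW EW]]; apply/asboolP; exists W; split=> //.
  by rewrite setIC.
by move=> x /EW.
Qed.

Let eqrmap_eq_trans : transitive eqrmap_eq.
Proof.
move=> psi phi chi /asboolP[W [oW dW sW EW]] /asboolP[V [oV dV sV EV]].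
apply/asboolP; exists (W `&` V); split; first exact: openI.
- exact: denseI.
- by move=> x [/sW[? _] /sV[_ ?]].
- by move=> x [/EW-> /EV].
Qed.

Canonical eqrmap_equiv :=
  EquivRel eqrmap_eq eqrmap_eq_refl eqrmap_eq_sym eqrmap_eq_trans.

(* Only the ring structure is declared: k acts through the constant maps with
   values in scalar matrices. *)
Definition RMaps : Type := {eq_quot eqrmap_eq}.
HB.instance Definition _ := Choice.on RMaps.

Definition rmaps (phi : eqrmap) : RMaps := \pi_({eq_quot eqrmap_eq}) phi.
Definition rmaps_repr (a : RMaps) : eqrmap := repr (a : {eq_quot eqrmap_eq}).

Lemma rmaps_reprK a : rmaps (rmaps_repr a) = a.
Proof. exact: reprK. Qed.

Lemma rmapsW (P : RMaps -> Prop) :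
  (forall phi, P (rmaps phi)) -> forall a, P a.
Proof. by move=> Prmaps a; rewrite -(rmaps_reprK a). Qed.

Lemma eq_rmaps (phi psi : eqrmap) : rmaps phi = rmaps psi <-> rmap_eq phi psi.
Proof. by split=> [/eqmodP/asboolP|E]; last exact/eqmodP/asboolP. Qed.

Section Constants.
Variable C : 'M[k]_n.
Hypothesis C_conj : forall g, pgl_conj g C = C.

Fact cst_morphism (x : X) :
  setT x -> morphism_at (fun _ : X => C : zariski 'M[k]_n) x.
Proof. by move=> _; apply/morphism_matrixP => i j; exact: regular_at_cst. Qed.

Fact cst_equivariant :
  equivariant (@pgl_conj k n) (rdom (RMap openT dense_open_T cst_morphism))
    (fun _ : X => C).
Proof. by move=> g x _ _; rewrite C_conj. Qed.

Definition eqrmap_cst : eqrmap := EqRMap cst_equivariant.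
End Constants.

Section Operations.
Variable op : 'M[k]_n -> 'M[k]_n -> 'M[k]_n.
Hypothesis op_morphism : forall (phi psi : X -> zariski 'M[k]_n) x,
  morphism_at phi x -> morphism_at psi x ->
  morphism_at (fun y => op (phi y) (psi y) : zariski 'M[k]_n) x.
Hypothesis op_conj : forall g A B,
  pgl_conj g (op A B) = op (pgl_conj g A) (pgl_conj g B).
Variables phi psi : eqrmap.

Fact op_open : open (rdom phi `&` rdom psi).
Proof. by apply: openI; exact: rdom_open. Qed.

Fact op_dense : dense (rdom phi `&` rdom psi).
Proof.
by apply: denseI; [exact: rdom_open|exact: rdom_dense|exact: rdom_dense].
Qed.

Fact op_rfun_morphism x : (rdom phi `&` rdom psi) x ->
  morphism_at (fun y => op (phi y) (psi y) : zariski 'M[k]_n) x.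
Proof. by move=> [? ?]; apply: op_morphism; exact: rfun_morphism. Qed.

Fact op_equivariant : equivariant (@pgl_conj k n)
  (rdom (RMap op_open op_dense op_rfun_morphism))
  (fun y => op (phi y) (psi y)).
Proof.
by move=> g x [? ?] [? ?]; rewrite op_conj !eqrmap_equivariant.
Qed.

Definition eqrmap_op : eqrmap := EqRMap op_equivariant.
End Operations.

Section OperationsQuotient.
Variable op : 'M[k]_n -> 'M[k]_n -> 'M[k]_n.
Hypothesis op_morphism : forall (phi psi : X -> zariski 'M[k]_n) x,
  morphism_at phi x -> morphism_at psi x ->
  morphism_at (fun y => op (phi y) (psi y) : zariski 'M[k]_n) x.
Hypothesis op_conj : forall g A B,
  pgl_conj g (op A B) = op (pgl_conj g A) (pgl_conj g B).
Let eop := eqrmap_op op_morphism op_conj.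

Definition rmaps_op (a b : RMaps) : RMaps :=
  rmaps (eop (rmaps_repr a) (rmaps_repr b)).

Lemma rmaps_opE phi psi : rmaps_op (rmaps phi) (rmaps psi) = rmaps (eop phi psi).
Proof.
have /eq_rmaps[W [oW dW sW EW]] := rmaps_reprK (rmaps phi).
have /eq_rmaps[V [oV dV sV EV]] := rmaps_reprK (rmaps psi).
apply/eq_rmaps; exists (W `&` V); split; first exact: openI.
- exact: denseI.
- by move=> x [/sW[? ?] /sV[? ?]].
- by move=> x [Wx Vx] /=; rewrite (EW x Wx) (EV x Vx).
Qed.
End OperationsQuotient.

Lemma add_morphism (phi psi : X -> zariski 'M[k]_n) x :
  morphism_at phi x -> morphism_at psi x ->
  morphism_at (fun y => (phi y : 'M_n) + (psi y : 'M_n) : zariski 'M[k]_n) x.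
Proof.
move=> /morphism_matrixP rphi /morphism_matrixP rpsi.
apply/morphism_matrixP => i j.
apply: (regular_at_eq _ (regular_at_add (rphi i j) (rpsi i j))).
by apply: near_all => y; rewrite mxE.
Qed.

Lemma sub_morphism (phi psi : X -> zariski 'M[k]_n) x :
  morphism_at phi x -> morphism_at psi x ->
  morphism_at (fun y => (phi y : 'M_n) - (psi y : 'M_n) : zariski 'M[k]_n) x.
Proof.
move=> /morphism_matrixP rphi /morphism_matrixP rpsi.
apply/morphism_matrixP => i j.
apply: (regular_at_eq _ (regular_at_add (rphi i j)
  (regular_at_mul (regular_at_cst x (-1 : k)) (rpsi i j)))).
by apply: near_all => y; rewrite !mxE mulN1r.
Qed.

Lemma mul_morphism (phi psi : X -> zariski 'M[k]_n) x :
  morphism_at phi x -> morphism_at psi x ->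
  morphism_at (fun y => (phi y : 'M_n) *m (psi y : 'M_n) : zariski 'M[k]_n) x.
Proof.
move=> /morphism_matrixP rphi /morphism_matrixP rpsi.
apply/morphism_matrixP => i j.
have rS : regular_at x (fun y =>
    \sum_l (phi y : 'M[k]_n) i l * (psi y : 'M[k]_n) l j).
  by apply: regular_at_sum => l; exact: regular_at_mul.
by apply: (regular_at_eq _ rS); apply: near_all => y; rewrite mxE.
Qed.

Lemma add_conj g (A B : 'M[k]_n) :
  pgl_conj g (A + B) = pgl_conj g A + pgl_conj g B.
Proof. by rewrite /pgl_conj mulmxDr mulmxDl. Qed.

Lemma sub_conj g (A B : 'M[k]_n) :
  pgl_conj g (A - B) = pgl_conj g A - pgl_conj g B.
Proof. by rewrite /pgl_conj mulmxBr mulmxBl. Qed.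

Lemma mul_conj g (A B : 'M[k]_n) :
  pgl_conj g (A *m B) = pgl_conj g A *m pgl_conj g B.
Proof.
rewrite /pgl_conj !mulmxA -[_ *m invmx _ *m gl_mx _]mulmxA.
by rewrite mulVmx ?gl_mx_unit // mulmx1.
Qed.

Lemma zero_conj g : pgl_conj g 0 = 0 :> 'M[k]_n.
Proof. by rewrite /pgl_conj mulmx0 mul0mx. Qed.

Lemma one_conj g : pgl_conj g 1%:M = 1%:M :> 'M[k]_n.
Proof. by rewrite /pgl_conj mulmx1 mulmxV ?gl_mx_unit. Qed.

Definition rmaps_zero : RMaps := rmaps (eqrmap_cst zero_conj).
Definition rmaps_one : RMaps := rmaps (eqrmap_cst one_conj).
Definition rmaps_add : RMaps -> RMaps -> RMaps :=
  rmaps_op add_morphism add_conj.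
Definition rmaps_sub : RMaps -> RMaps -> RMaps :=
  rmaps_op sub_morphism sub_conj.
Definition rmaps_opp (a : RMaps) : RMaps := rmaps_sub rmaps_zero a.
Definition rmaps_mul : RMaps -> RMaps -> RMaps :=
  rmaps_op mul_morphism mul_conj.

Local Ltac rmaps_tac :=
  rewrite /associative /commutative /left_id /right_id /left_inverse
    /left_distributive /right_distributive;
  repeat match goal with |- forall a : RMaps, _ => refine (rmapsW _); intro end;
  rewrite /rmaps_opp /rmaps_add /rmaps_sub /rmaps_mul
    /rmaps_zero /rmaps_one ?rmaps_opE;
  apply/eq_rmaps/eqrmap_eqW => x /=.

Let rmaps_addA : associative rmaps_add.
Proof. by rmaps_tac; rewrite addrA. Qed.
Let rmaps_addC : commutative rmaps_add.
Proof. by rmaps_tac; rewrite addrC. Qed.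
Let rmaps_add0 : left_id rmaps_zero rmaps_add.
Proof. by rmaps_tac; rewrite add0r. Qed.
Let rmaps_addN : left_inverse rmaps_zero rmaps_opp rmaps_add.
Proof. by rmaps_tac; rewrite sub0r addNr. Qed.
Let rmaps_mulA : associative rmaps_mul.
Proof. by rmaps_tac; rewrite mulmxA. Qed.
Let rmaps_mul1 : left_id rmaps_one rmaps_mul.
Proof. by rmaps_tac; rewrite mul1mx. Qed.
Let rmaps_1mul : right_id rmaps_one rmaps_mul.
Proof. by rmaps_tac; rewrite mulmx1. Qed.
Let rmaps_mulDl : left_distributive rmaps_mul rmaps_add.
Proof. by rmaps_tac; rewrite mulmxDl. Qed.
Let rmaps_mulDr : right_distributive rmaps_mul rmaps_add.
Proof. by rmaps_tac; rewrite mulmxDr. Qed.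

HB.instance Definition _ := GRing.isZmodule.Build RMaps
  rmaps_addA rmaps_addC rmaps_add0 rmaps_addN.
HB.instance Definition _ := GRing.Zmodule_isPzRing.Build RMaps
  rmaps_mulA rmaps_mul1 rmaps_1mul rmaps_mulDl rmaps_mulDr.

End RMaps.

Section CentralSimple.
Variable R : pzRingType.

Definition two_sided_ideal (I : set R) : Prop :=
  [/\ I 0, forall a b, I a -> I b -> I (a + b),
      forall r a, I a -> I (r * a) & forall r a, I a -> I (a * r)].

Definition simple_ring : Prop :=
  1 != 0 :> R /\
  forall I : set R, two_sided_ideal I -> I = [set 0] \/ I = setT.

Definition center : set R := [set z | forall r, z * r = r * z].

Definition basis_over_center (d : nat) (b : 'I_d -> R) : Prop :=
  forall r, exists! c : {ffun 'I_d -> R},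
    (forall i, center (c i)) /\ r = \sum_i c i * b i.

(* the center of a simple ring is a field *)
Definition central_simple_of_degree (n : nat) : Prop :=
  simple_ring /\ exists b : 'I_(n ^ 2) -> R, basis_over_center b.

End CentralSimple.

(* Main.v *)
From HB Require Import structures.
Require Import Defs.
From mathcomp Require Import all_boot all_order all_algebra.
From mathcomp Require Import all_classical topology.
From mathcomp.multinomials Require mpoly.

Set Implicit Arguments.
Unset Strict Implicit.
Unset Printing Implicit Defensive.

Import GRing.Theory.

Local Open Scope classical_set_scope.
Local Open Scope ring_scope.
Local Open Scope quotient_scope.

(** Both conditions say that the values of equivariant rational maps from X
    to the n x n matrices fill the whole matrix algebra at a general point
    of X. Write A for the ring of these maps.

    Suppose that f : X --> Y is given. The values at a point of the elements
    of A defined there form a subalgebra; it contains the components of f,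
    hence is everything ([generating_attained_values]). So some n ^ 2
    elements of A have values that form a basis at one point, thus at a
    general point. By Cramer's rule every element of A is a combination of
    them, and the coefficients are invariant rational functions because
    coordinates in a basis are unique; these functions are the centre of A
    ([basis_of_generic_basis]). A nonzero ideal contains products that take
    the matrix units as values at some point. They too form a basis of A
    over its centre, and so 1 belongs to the ideal
    ([attained_values_central_simple]).

    Conversely let A be central simple with basis b over its centre. By the
    theorem of Artin and Whaples some operators T_j, built from left and
    right multiplications, satisfy T_j b_j = 1 and T_j b_i = 0 for i <> j
    ([artin_whaples]). Multiplications preserve linear relations between
    values at a general point x, so T_j turns a relation sum_i c_i b_i(x) =
    0 into c_j = 0. Hence the b_i(x) are a basis
    ([central_simple_generic_basis]). An element of PGL_n that fixes x
    commutes with them, therefore it is trivial ([generic_basis_free]).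

    The tuple b maps X equivariantly to generating tuples; the closure of
    its image is an n-variety ([image_n_variety]). To make the map
    injective, invariant functions, as scalar matrices, are added to b. They
    come from a variant of Rosenlicht's argument. Let h be a coordinate
    function of an affine chart of X. As the action is a morphism, h(gx) is
    locally a quotient of sums of products of a regular function of g and
    one of x. Now g can be recovered up to a scalar, linearly, from b(gx),
    with coefficients that depend on x ([transportE]). This gives D(x, y)
    h(y) = N(x, y) for all y in the orbit of x, where D and N are sums of
    terms c(x) m(y) with finitely many functions m that factor through b
    ([regular_on_orbits]). Let v(y) be the vector with the entries m(y)
    h(y), for m in D, and m(y), for m in N. The span of v over an orbit
    depends on the orbit only, so its normalized basis has invariant
    entries, and these are regular functions ([orbit_span_invariants]). If b
    and these invariants take the same values at x and x', then the equation
    of x holds at x', where it reads D(x, x) h(x') = N(x, x), and so h(x') =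
    h(x) ([separating_invariants]). *)

(** * Generic points of an irreducible space *)

Section Generically.
Variable T : topologicalType.

(** The filter of properties of points in general position. It is proper when
    T is irreducible, which lets finitely many generic properties be combined
    with the usual tools for filters. *)
Definition generically : set_system T :=
  [set P | exists W : set T, [/\ open W, W !=set0 & W `<=` P]].

Lemma open_generically (W : set T) : open W -> W !=set0 -> generically W.
Proof. by move=> oW W0; exists W; split=> // x. Qed.

Lemma near_generically (x : T) (P : set T) : nbhs x P -> generically P.
Proof. by rewrite nbhsE => -[O [oO Ox] OP]; exists O; split=> //; exists x. Qed.

Lemma irreducible_openP : irreducible T <->
  [set: T] !=set0 /\ (forall A B : set T,
     open A -> open B -> A !=set0 -> B !=set0 -> A `&` B !=set0).
Proof.
split=> -[T0 irr]; split=> // A B.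
  move=> oA oB [a Aa] [b Bb]; apply/set0P/eqP => AB0.
  have [|||A'|B'] := irr (~` A) (~` B).
  - exact: open_closedC.
  - exact: open_closedC.
  - by rewrite -setCI AB0 setC0.
  - by have : (~` A) a by rewrite A'.
  - by have : (~` B) b by rewrite B'.
move=> cA cB AB; case: (pselect (~` A !=set0)) => [A0|/set0P/negP].
  case: (pselect (~` B !=set0)) => [B0|/set0P/negP].
    have [x [Ax Bx]] := irr _ _ (closed_openC cA) (closed_openC cB) A0 B0.
    by have : (A `|` B) x by [rewrite AB]; case.
  by rewrite negbK => /eqP B0; right; rewrite -[B]setCK B0 setC0.
by rewrite negbK => /eqP A0; left; rewrite -[A]setCK A0 setC0.
Qed.

Hypothesis irrT : irreducible T.

Lemma generically_proper : ProperFilter generically.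
Proof.
have [T0 irr] := irreducible_openP.1 irrT; split.
  by move=> [W [_ [x Wx] /(_ x Wx)]].
split.
- by exists setT; split=> //; exact: openT.
- move=> P Q [U [oU U0 UP]] [V [oV V0 VQ]]; exists (U `&` V).
  by split; [exact: openI|exact: irr|apply: setISS].
- by move=> P Q PQ [W [oW W0 WP]]; exists W; split=> // x /WP/PQ.
Qed.

Lemma open_dense (W : set T) : open W -> W !=set0 -> dense W.
Proof.
move=> oW W0 O O0 oO.
by have [_ irr] := irreducible_openP.1 irrT; exact: irr.
Qed.

Lemma dense_generically (W : set T) : open W -> dense W -> generically W.
Proof.
move=> oW dW; apply: open_generically => //.
have [T0 _] := irrT.
by have [x [_ Wx]] := dW setT T0 openT; exists x.
Qed.

End Generically.

(** * Matrices of regular functions *)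

Section RegularMatrices.
Variables (k : fieldType) (X : funSpaceType k).

Definition mx_regular_at p q (x : X) (M : X -> 'M[k]_(p, q)) : Prop :=
  forall i j, regular_at x (fun y => M y i j).

Lemma regular_at_ext x (f g : X -> k) :
  f =1 g -> regular_at x f -> regular_at x g.
Proof. by move=> fg; apply: regular_at_eq; exact: near_all. Qed.

Lemma regular_at_det p x (M : X -> 'M[k]_p) :
  mx_regular_at x M -> regular_at x (fun y => \det (M y)).
Proof.
move=> rM; apply: regular_at_sum => s; apply: regular_at_mul.
  exact: regular_at_cst.
by apply: regular_at_prod => i; exact: rM.
Qed.

Lemma mx_regular_at_mul p q r x (M : X -> 'M[k]_(p, q))
    (N : X -> 'M[k]_(q, r)) :
  mx_regular_at x M -> mx_regular_at x N ->
  mx_regular_at x (fun y => M y *m N y).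
Proof.
move=> rM rN i j.
apply: (@regular_at_ext _ (fun y => \sum_l M y i l * N y l j)).
  by move=> y; rewrite mxE.
by apply: regular_at_sum => l; exact: regular_at_mul.
Qed.

Lemma mx_regular_at_inv p x (M : X -> 'M[k]_p) :
  mx_regular_at x M -> M x \in unitmx ->
  mx_regular_at x (fun y => invmx (M y)).
Proof.
move=> rM; rewrite unitmxE unitfE => Mx i j.
apply: (@regular_at_eq _ _ _
  (fun y => (\det (M y))^-1 * cofactor (M y) j i)); last first.
  apply: regular_at_mul.
    by apply: regular_at_inv Mx; exact: regular_at_det.
  apply: regular_at_mul; first exact: regular_at_cst.
  apply: regular_at_det => a b.
  by apply: regular_at_ext (rM (lift j a) (lift i b)) => y; rewrite !mxE.
apply: filterS (regular_at_neq0 (regular_at_det rM) Mx) => y My.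
by rewrite /invmx unitmxE unitfE My !mxE.
Qed.

Lemma mx_regular_at_unit p x (M : X -> 'M[k]_p) :
  mx_regular_at x M -> M x \in unitmx -> \forall y \near x, M y \in unitmx.
Proof.
rewrite unitmxE unitfE => rM Mx.
apply: filterS (regular_at_neq0 (regular_at_det rM) Mx) => y.
by rewrite unitmxE unitfE.
Qed.

End RegularMatrices.

(** * Morphisms and the action *)

Section MorphismComposition.
Variable k : fieldType.

Lemma morphism_at_comp (X Y Z : funSpaceType k) (f : X -> Y) (g : Y -> Z) x :
  morphism_at f x -> morphism_at g (f x) -> morphism_at (g \o f) x.
Proof.
move=> [cf rf] [cg rg]; split; first exact: continuous_comp.
by move=> h /rg/rf.
Qed.

Lemma morphism_at_eq (X Y : funSpaceType k) (f g : X -> Y) x :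
  (\forall y \near x, f y = g y) -> morphism_at f x -> morphism_at g x.
Proof.
move=> fg [cf rf]; have fgx := nbhs_singleton fg; split.
  move=> U; rewrite /= -fgx => Ux.
  have fU : \forall y \near x, U (f y) by exact: cf.
  have gU : \forall y \near x, U (g y) by apply: filterS2 fg fU => y ->.
  exact: gU.
move=> h; rewrite -fgx => /rf; apply: regular_at_eq.
by apply: filterS fg => y /= ->.
Qed.

Lemma set_val_morphism (X : funSpaceType k) (A : set X) (x : A) :
  morphism_at (set_val : A -> X) x.
Proof.
split; first exact: (@initial_continuous _ _ (set_val : A -> X)).
by move=> g rg; exists g => //; exact: near_all.
Qed.

(** A function regular on A is locally the restriction of one on Y, so it is
    enough to test the composition with the inclusion. *)
Lemma morphism_at_set_type (X Y : funSpaceType k) (A : set Y) (f : X -> A) x :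
  morphism_at (fun y => set_val (f y)) x -> morphism_at f x.
Proof.
move=> [cf rf].
have cfx : {for x, continuous f}.
  move=> U /=; rewrite nbhsE => -[O [[V oV VO] Ox] OU].
  have : nbhs (set_val (f x)) V.
    apply: open_nbhs_nbhs; split=> //.
    by rewrite -[V _]/((set_val @^-1` V) _) VO.
  move=> Vx; have fV : \forall y \near x, V (set_val (f y)) by exact: cf.
  have fU : \forall y \near x, U (f y).
    by apply: filterS fV => y Vy; apply: OU; rewrite -VO.
  exact: fU.
split=> // g [h rh gh]; apply: (regular_at_eq _ (rf h rh)).
have gf : \forall y \near x, g (f y) = h (set_val (f y)) 
  by have := cfx [set y | g y = h (set_val y)] gh.
by apply: filterS gf => y /= ->.
Qed.

Lemma teval_regular_r (Y X : funSpaceType k) (t : tensor Y X k) y x :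
  tregular t (y, x) -> regular_at x (fun x' => teval t (y, x')).
Proof.
move=> rt; apply: regular_at_sum => i; apply: regular_at_mul.
  exact: (regular_at_cst x (tensor_left i y : k)).
exact: (rt i).2.
Qed.

Lemma zprod_nbhsP (Y X : funSpaceType k) (z : zprod Y X) (W : set (zprod Y X)) :
  nbhs z W -> exists (t : tensor Y X k) (U : set Y) (V : set X),
    [/\ nbhs z.1 U, nbhs z.2 V, tregular t z, teval t z != 0 &
        forall z' : Y * X, U z'.1 -> V z'.2 -> teval t z' != 0 -> W z'].
Proof.
rewrite nbhsE => -[O [oO Oz] OW].
have /(_ z Oz)[t [U [V [? ? ? ? UVO]]]] : zprod_open O by [].
by exists t, U, V; split=> // z' ? ? ?; apply: OW; exact: UVO.
Qed.

Lemma pair_morphism (Y X : funSpaceType k) (y : Y) :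
  morphism ((fun x => (y, x)) : X -> zprod Y X).
Proof.
move=> x; have cp : {for x, continuous ((fun x => (y, x)) : X -> zprod Y X)}.
  move=> W /zprod_nbhsP[t [U [V [yU xV rt tz UVW]]]].
  have pW : \forall x' \near x, W (y, x').
    apply: filterS2 xV (regular_at_neq0 (teval_regular_r rt) tz) => x' Vx' tx'.
    by apply: UVW => //; exact: nbhs_singleton yU.
  exact: pW.
split=> // g [s [t [rs rt tz gE]]].
apply: (@regular_at_eq _ _ _ (fun x => teval s (y, x) / teval t (y, x))).
  have gx : \forall x' \near x, g (y, x') = teval s (y, x') / teval t (y, x').
    by have := cp [set z | g z = teval s z / teval t z] gE.
  by apply: filterS gx => x' /= ->.
exact: (regular_at_mul (teval_regular_r rs)
  (regular_at_inv (teval_regular_r rt) tz)).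
Qed.

Lemma gact_morphism_l n (X : PGLvariety k n) (g : PGL k n) :
  morphism (gact g : X -> X).
Proof.
move=> x; exact: (morphism_at_comp (pair_morphism g x) (gact_morphism (g, x))).
Qed.

End MorphismComposition.

(** * The theorem of Artin and Whaples *)

Section MultiplicationOperators.
Variable R : pzRingType.

(** The multiplication algebra of R, as a set of functions: the maps
    x |-> sum_i u_i * x * v_i. *)
Inductive mulop : (R -> R) -> Prop :=
| mulop_id : mulop id
| mulop_l u T : mulop T -> mulop (fun x => u * T x)
| mulop_r u T : mulop T -> mulop (fun x => T x * u)
| mulop_add S T : mulop S -> mulop T -> mulop (fun x => S x + T x).

Lemma mulop_comp S T : mulop S -> mulop T -> mulop (S \o T).
Proof.
move=> mS mT; elim: mS => [|u S' _ IH|u S' _ IH|S1 S2 _ IH1 _ IH2].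
- exact: mT.
- exact: mulop_l IH.
- exact: mulop_r IH.
- exact: mulop_add IH1 IH2.
Qed.

Lemma mulop_sub S T : mulop S -> mulop T -> mulop (fun x => S x - T x).
Proof.
move=> mS mT; have := mulop_add mS (mulop_l (-1) mT).
by congr mulop; apply/funext => x; rewrite mulN1r.
Qed.

Lemma mulop_sum m (T : nat -> R -> R) :
  (forall i, (i < m)%N -> mulop (T i)) -> mulop (fun x => \sum_(i < m) T i x).
Proof.
elim: m => [|m IH] mT.
  have := mulop_l 0 mulop_id.
  by congr mulop; apply/funext => x; rewrite big_ord0 mul0r.
have := mulop_add (IH (fun i im => mT i (ltnW im))) (mT m (ltnSn m)).
by congr mulop; apply/funext => x; rewrite big_ord_recr.
Qed.

Lemma mulop0 T : mulop T -> T 0 = 0.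
Proof.
elim=> [//|u S _ ->|u S _ ->|S1 S2 _ -> _ ->]; first exact: mulr0.
  exact: mul0r.
exact: addr0.
Qed.

Hypothesis simpleR : simple_ring R.

(** The images of a under multiplication operators are the ideal of a. *)
Lemma simple_mulop_unit (a : R) : a != 0 -> exists2 S, mulop S & S a = 1.
Proof.
move=> a0; pose I : set R := [set b | exists2 S, mulop S & S a = b].
have idI : two_sided_ideal I.
  split.
  - by exists (fun x => 0 * x); [exact: mulop_l mulop_id|rewrite mul0r].
  - by move=> _ _ [S mS <-] [T mT <-]; exists (fun x => S x + T x);
      [exact: mulop_add|].
  - by move=> r _ [S mS <-]; exists (fun x => r * S x); [exact: mulop_l|].
  - by move=> r _ [S mS <-]; exists (fun x => S x * r); [exact: mulop_r|].
have Ia : I a by exists id => //; exact: mulop_id.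
have [I0|IT] := simpleR.2 I idI.
  by move: Ia a0; rewrite I0 => /= ->; rewrite eqxx.
by have : I 1 by rewrite IT.
Qed.

(** Induction on m. Operators T_j dual to the first m elements are given. If
    some operator S kills these but not a_m, then simplicity turns S into
    a dual operator for a_m, by which the T_j are corrected. Otherwise every
    operator that kills a_0, ..., a_(m-1) also kills a_m. Applied to
    x |-> r * T_j x - T_j x * r this shows that T_j a_m is central; applied to
    x |-> sum_j T_j x * a_j - x it shows that a_m is the combination of the a_j
    with these coefficients, against the freeness of a.
    The elements are indexed by nat, only the first m of them matter. *)
Lemma artin_whaples m (a : nat -> R) :
  (forall c : nat -> R, (forall i, center (c i)) ->
     \sum_(i < m) c i * a i = 0 -> forall i, (i < m)%N -> c i = 0) ->
  exists T : nat -> R -> R, (forall j, (j < m)%N -> mulop (T j)) /\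
    forall i j, (i < m)%N -> (j < m)%N -> T j (a i) = (i == j)%:R.
Proof.
have center0 : center (0 : R) by move=> r; rewrite mul0r mulr0.
elim: m => [|m IHm] freea; first by exists (fun _ => id); split.
have [|T [mT Ta]] := IHm.
  move=> c cc ca i im.
  pose c' j := if (j < m)%N then c j else 0.
  have := freea c' _ _ i (ltnW im); rewrite /c' im; apply=> [j|].
    by case: ifP.
  rewrite big_ord_recr /= ltnn mul0r addr0 -[RHS]ca.
  by apply: eq_bigr => j _; rewrite ltn_ord.
have [[S [mS Sa Sm]]|noS] := pselect (exists S,
    [/\ mulop S, forall i, (i < m)%N -> S (a i) = 0 & S (a m) != 0]).
  have [U mU Um] := simple_mulop_unit Sm.
  exists (fun j => if j == m then U \o S
                   else fun x => T j x - T j (a m) * U (S x)); split.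
    move=> j; rewrite ltnS leq_eqVlt; case: eqP => [_ _|_ /= jm].
      exact: mulop_comp.
    apply: mulop_sub; first exact: mT.
    by apply: mulop_l; exact: mulop_comp.
  move=> i j; rewrite ltnS leq_eqVlt => /predU1P[->|im].
    rewrite ltnS leq_eqVlt; case: (eqVneq j m) => [-> _|jm _ /=].
      exact: Um.
    by rewrite Um mulr1 subrr.
  rewrite ltnS leq_eqVlt; case: (eqVneq j m) => [-> _|jm /= jltm].
    by rewrite /= Sa // (mulop0 mU) (ltn_eqF im).
  by rewrite Sa // (mulop0 mU) mulr0 subr0; exact: Ta.
have kill S : mulop S -> (forall i, (i < m)%N -> S (a i) = 0) -> S (a m) = 0.
  by move=> mS Sa; apply/eqP/negPn/negP => Sm; apply: noS; exists S.
(* the coefficients of the relation sum_j T_j(a_m) a_j - a_m = 0 *)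
pose z j := if (j < m)%N then T j (a m) else -1.
have zc j : center (z j).
  rewrite /z; case: ifP => [jm r|_ r]; last by rewrite mulN1r mulrN1.
  apply/esym/eqP; rewrite -subr_eq0; apply/eqP.
  apply: (kill (fun x => r * T j x - T j x * r)).
    by apply: mulop_sub; [apply: mulop_l|apply: mulop_r]; exact: mT.
  by move=> i im; rewrite Ta //; case: eqP => _;
    rewrite ?mulr1 ?mul1r ?mulr0 ?mul0r subrr.
have za : \sum_(i < m.+1) z i * a i = 0.
  rewrite big_ord_recr /= {2}/z ltnn mulN1r.
  apply: (kill (fun x =>
    \sum_(i < m) (if (i < m)%N then T i x else -1) * a i - x)).
    apply: mulop_sub mulop_id; apply: (@mulop_sum m
      (fun i x => (if (i < m)%N then T i x else -1) * a i)) => i im.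
    by rewrite im; apply: mulop_r; exact: mT.
  move=> i im; rewrite (bigD1 (Ordinal im)) //= im Ta // eqxx mul1r big1.
    by rewrite addr0 subrr.
  move=> j /negPf ji; rewrite ltn_ord Ta //.
  rewrite (_ : (i == j) = false) ?mul0r //.
  by rewrite eq_sym; exact: ji.
have := freea z zc za m (ltnSn m); rewrite /z ltnn => /eqP.
by rewrite oppr_eq0 (negPf simpleR.1).
Qed.

End MultiplicationOperators.

(** * Conjugation of matrices *)

Section Conjugation.
Variables (k : fieldType) (n : nat).

Lemma pgl_conj_sum (I : finType) (g : PGL k n) (c : I -> k) (M : I -> 'M[k]_n) :
  pgl_conj g (\sum_i c i *: M i) = \sum_i c i *: pgl_conj g (M i).
Proof.
rewrite /pgl_conj mulmx_sumr mulmx_suml; apply: eq_bigr => i _.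
by rewrite -scalemxAr -scalemxAl.
Qed.

Lemma pgl_conj_scalar (g : PGL k n) (c : k) : pgl_conj g c%:M = c%:M.
Proof.
rewrite /pgl_conj mul_mx_scalar -scalemxAl mulmxV ?gl_mx_unit //.
by rewrite scalemx1.
Qed.

Lemma pgl_conj_comm (g : PGL k n) (M : 'M[k]_n) :
  pgl_conj g M = M -> gl_mx (pgl_repr g) *m M = M *m gl_mx (pgl_repr g).
Proof.
move=> E; rewrite -{2}E /pgl_conj.
by rewrite -[RHS]mulmxA mulVmx ?gl_mx_unit // mulmx1.
Qed.

End Conjugation.

Lemma central_mx_scalar (k : fieldType) n (M : 'M[k]_n) : (0 < n)%N ->
  (forall N, M *m N = N *m M) -> exists c, M = c%:M.
Proof.
case: n M => // n M _ cM; exists (M ord0 ord0); apply/matrixP => i j.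
have mulMd (a b u v : 'I_n.+1) : (M *m delta_mx a b) u v = M u a *+ (v == b).
  rewrite mxE (bigD1 a) //= mxE eqxx big1 => [|l /negPf la].
    by rewrite addr0 mulr_natr.
  by rewrite mxE la mulr0.
have muldM (a b u v : 'I_n.+1) : (delta_mx a b *m M) u v = M b v *+ (u == a).
  rewrite mxE (bigD1 b) //= mxE eqxx andbT big1 => [|l /negPf lb].
    by rewrite addr0 mulr_natl.
  by rewrite mxE lb andbF mul0r.
have := mulMd j ord0 i ord0; rewrite cM muldM !eqxx => /esym.
by rewrite mxE mulr1n => ->; rewrite eq_sym.
Qed.

(** * Generic values of equivariant rational maps *)

Section GenericValues.
Variables (k : fieldType) (n : nat) (X : PGLvariety k n).

(** The value with its type of matrix, rather than of point of affine space. *)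
Definition mval (phi : eqrmap X) (x : X) : 'M[k]_n := phi x.
(** An element of RMaps has no value at a given point, only one for each
    representative. The value of the chosen representative is compatible with
    the ring operations at a general point, which is all that is needed. *)
Definition gval (a : RMaps X) (x : X) : 'M[k]_n := mval (rmaps_repr a) x.

Lemma mval_regular (phi : eqrmap X) x :
  rdom phi x -> mx_regular_at x (mval phi).
Proof.
by move=> dx i j; have /morphism_matrixP := rfun_morphism dx; exact.
Qed.

Lemma mval_equivariant (phi : eqrmap X) g x :
  rdom phi x -> rdom phi (gact g x) ->
  mval phi (gact g x) = pgl_conj g (mval phi x).
Proof. exact: eqrmap_equivariant. Qed.

(** The values e_i(x) are a basis of the matrix algebra exactly when this
    matrix is invertible. *)
Definition value_mx (e : 'I_(n * n) -> X -> 'M[k]_n) (x : X) : 'M[k]_(n * n) :=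
  \matrix_i mxvec (e i x).

Lemma mul_value_mx e x (c : 'rV[k]_(n * n)) :
  c *m value_mx e x = mxvec (\sum_i c 0 i *: e i x).
Proof.
rewrite mulmx_sum_row linear_sum; apply: eq_bigr => i _.
by rewrite rowK linearZ.
Qed.

Lemma value_mx_regular (e : 'I_(n * n) -> X -> 'M[k]_n) x :
  (forall i, mx_regular_at x (e i)) -> mx_regular_at x (value_mx e).
Proof.
move=> re i j; case/mxvec_indexP: j => a b.
by apply: regular_at_ext (re i a b) => y; rewrite mxE mxvecE.
Qed.

Definition coordinates (e : 'I_(n * n) -> X -> 'M[k]_n) (x : X) (M : 'M[k]_n) :
  'rV[k]_(n * n) := mxvec M *m invmx (value_mx e x).

Lemma coordinatesK e x M : value_mx e x \in unitmx ->
  \sum_i coordinates e x M 0 i *: e i x = M.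
Proof.
by move=> eu; apply: (can_inj mxvecK); rewrite -mul_value_mx mulmxKV.
Qed.

Lemma value_mx_inj e x (c d : 'I_(n * n) -> k) : value_mx e x \in unitmx ->
  \sum_i c i *: e i x = \sum_i d i *: e i x -> c =1 d.
Proof.
move=> eu E i; have := mul_value_mx e x (\row_j c j).
under eq_bigr => j _ do rewrite mxE.
rewrite E; have := mul_value_mx e x (\row_j d j).
under eq_bigr => j _ do rewrite mxE.
move=> <- /(can_inj (mulmxK eu)) /matrixP/(_ 0 i).
by rewrite !mxE.
Qed.

Lemma scalar_eqrmap (W : set X) (c : X -> k) : open W -> dense W ->
  (forall x, W x -> regular_at x c) ->
  (forall g x, W x -> W (gact g x) -> c (gact g x) = c x) ->
  exists2 psi : eqrmap X, rdom psi = W & forall x, mval psi x = (c x)%:M.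
Proof.
move=> oW dW rc cg; pose phi x : zariski 'M[k]_n := (c x)%:M.
have mphi x : W x -> morphism_at phi x.
  move=> /rc rcx; apply/morphism_matrixP => i j.
  apply: (@regular_at_ext _ _ _ (fun y => c y * (i == j)%:R)).
    by move=> y; rewrite mxE mulr_natr.
  by apply: regular_at_mul => //; exact: regular_at_cst.
have ephi : equivariant (@pgl_conj k n) (rdom (RMap oW dW mphi)) phi.
  by move=> g x Wx Wgx; rewrite /phi pgl_conj_scalar cg.
by exists (EqRMap ephi).
Qed.

Hypothesis irrX : irreducible X.
Local Notation G := (@generically X).
Let G_proper : ProperFilter G := generically_proper irrX.
#[local] Existing Instance G_proper.

Lemma rdom_generic (phi : eqrmap X) : \forall x \near G, rdom phi x.
Proof.
by apply: dense_generically => //; [exact: rdom_open|exact: rdom_dense].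
Qed.

Lemma gval_rmaps (phi : eqrmap X) :
  \forall x \near G, gval (rmaps phi) x = mval phi x.
Proof.
have /eq_rmaps[W [oW dW _ E]] := rmaps_reprK (rmaps phi).
by apply: filterS (dense_generically irrX oW dW).
Qed.

Lemma gval_inj (a b : RMaps X) :
  (\forall x \near G, gval a x = gval b x) -> a = b.
Proof.
move=> ab; rewrite -(rmaps_reprK a) -(rmaps_reprK b); apply/eq_rmaps.
have [W [oW W0 WP]] := filterI ab
  (filterI (rdom_generic (rmaps_repr a)) (rdom_generic (rmaps_repr b))).
exists W; split=> //; first exact: open_dense.
  by move=> x /WP[].
by move=> x /WP[].
Qed.

Lemma gval0 : \forall x \near G, gval 0 x = 0.
Proof. exact: gval_rmaps. Qed.

Lemma gval1 : \forall x \near G, gval 1 x = 1%:M.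
Proof. exact: gval_rmaps. Qed.

Lemma gvalD a b : \forall x \near G, gval (a + b) x = gval a x + gval b x.
Proof. exact: gval_rmaps. Qed.

Lemma gvalM a b : \forall x \near G, gval (a * b) x = gval a x *m gval b x.
Proof. exact: gval_rmaps. Qed.

Lemma gval_sum (I : finType) (a : I -> RMaps X) :
  \forall x \near G, gval (\sum_i a i) x = \sum_i gval (a i) x.
Proof.
elim: (index_enum I) => [|i s IH].
  by apply: filterS gval0 => x E; rewrite !big_nil.
apply: filterS2 IH (gvalD (a i) (\sum_(j <- s) a j)) => x E1 E2.
by rewrite !big_cons E2 E1.
Qed.

Lemma generic_point_open (P : X -> Prop) : (\forall x \near G, P x) ->
  exists W : set X, [/\ open W, dense W, W !=set0 & W `<=` P].
Proof.
by move=> [W [oW W0 WP]]; exists W; split=> //; exact: open_dense.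
Qed.

Section Basis.
Hypothesis n_gt0 : (0 < n)%N.
Variable e : 'I_(n * n) -> eqrmap X.
Local Notation emx := (value_mx (fun i => mval (e i))).
Hypothesis e_basis : \forall x \near G, emx x \in unitmx.

Lemma rdoms_generic : \forall x \near G, forall i, rdom (e i) x.
Proof. by apply: filter_forall => i; exact: rdom_generic. Qed.

Lemma gval_rmaps_family :
  \forall x \near G, forall i, gval (rmaps (e i)) x = mval (e i) x.
Proof. by apply: filter_forall => i; exact: gval_rmaps. Qed.

(** At a general point z commutes with a basis, hence with all matrices. *)
Lemma center_gval (z : RMaps X) : center z ->
  \forall x \near G, exists c, gval z x = c%:M.
Proof.
move=> zc.
have comm : \forall x \near G, forall i,
    gval z x *m gval (rmaps (e i)) x = gval (rmaps (e i)) x *m gval z x.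
  apply: filter_forall => i; have := gvalM (rmaps (e i)) z.
  by rewrite -zc; apply: filterS2 (gvalM z (rmaps (e i))) => x <- <-.
apply: filterS3 comm gval_rmaps_family e_basis => x cx ex eu.
apply: central_mx_scalar => // N.
rewrite -(coordinatesK N eu) mulmx_sumr mulmx_suml.
by apply: eq_bigr => i _; rewrite -scalemxAr -scalemxAl -ex cx.
Qed.

Lemma scalar_center (psi : eqrmap X) (c : X -> k) :
  (forall x, mval psi x = (c x)%:M) -> center (rmaps psi).
Proof.
move=> E r; apply: gval_inj.
apply: filterS3 (gvalM r (rmaps psi)) (gvalM (rmaps psi) r) (gval_rmaps psi).
by move=> x -> -> ->; rewrite E scalar_mxC.
Qed.

(** The coefficients are the coordinates of the value of r, regular by Cramer's
    rule. At gx they are those of the conjugate of r(x) in the conjugate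
    basis, so they are the same as at x: scalar matrices with these entries
    are equivariant. Conversely central coefficients are scalar at a general
    point, where linear independence makes them unique. *)
Lemma basis_of_generic_basis :
  @basis_over_center (RMaps X) (n ^ 2) (fun i => rmaps (e i)).
Proof.
move=> r; pose rho := rmaps_repr r.
pose W := [set x | (forall i, rdom (e i) x) /\ rdom rho x /\ emx x \in unitmx].
have reg x : W x -> mx_regular_at x emx.
  by move=> [ex _]; apply: value_mx_regular => i; exact: mval_regular.
have oW : open W.
  rewrite openE => x Wx; have [ex [rx eu]] := Wx.
  have nd (phi : eqrmap X) : rdom phi x -> \forall y \near x, rdom phi y.
    by move=> dx; apply: open_nbhs_nbhs; split=> //; exact: rdom_open.
  have ne : \forall y \near x, forall i, rdom (e i) y.
    by apply: filter_forall => i; exact: nd.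
  apply: filterS3 ne (nd _ rx) (mx_regular_at_unit (reg x Wx) eu).
  by move=> y; split.
have GW : G W.
  by apply: filterS3 rdoms_generic (rdom_generic rho) e_basis => x; split.
have dW : dense W by apply: open_dense => //; exact: filter_ex GW.
pose c i x := coordinates (fun i => mval (e i)) x (mval rho x) 0 i.
have rc i x : W x -> regular_at x (c i).
  move=> Wx; have [ex [rx eu]] := Wx; apply: mx_regular_at_mul.
    move=> a b; case/mxvec_indexP: b => u v.
    by apply: regular_at_ext (mval_regular rx u v) => y; rewrite ord1 mxvecE.
  exact/mx_regular_at_inv/eu/reg.
have cg i g x : W x -> W (gact g x) -> c i (gact g x) = c i x.
  move=> [ex [rx eu]] [egx [rgx egu]].
  apply: (value_mx_inj egu (c := c ^~ (gact g x)) (d := c ^~ x)).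
  rewrite coordinatesK // mval_equivariant //.
  rewrite -{1}(coordinatesK (mval rho x) eu).
  by rewrite pgl_conj_sum; apply: eq_bigr => j _; rewrite mval_equivariant.
have /choice[C CP] i : exists psi : eqrmap X,
    rdom psi = W /\ forall x, mval psi x = (c i x)%:M.
  by have [psi ? ?] := scalar_eqrmap oW dW (rc i) (cg i); exists psi.
exists [ffun i => rmaps (C i)]; split.
  split=> [i|]; first by rewrite ffunE; exact: scalar_center (CP i).2.
  apply: gval_inj.
  have GC : \forall x \near G, forall i, gval (rmaps (C i)) x = mval (C i) x.
    by apply: filter_forall => i; exact: gval_rmaps.
  have GM : \forall x \near G, forall i : 'I_(n ^ 2),
    gval (rmaps (C i) * rmaps (e i)) x =
    gval (rmaps (C i)) x *m gval (rmaps (e i)) x.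
    by apply: filter_forall => i; exact: gvalM.
  have GS := gval_sum (fun i : 'I_(n ^ 2) => rmaps (C i) * rmaps (e i)).
  apply: filterS3 (filterI GS GW) (filterI GC GM) gval_rmaps_family.
  move=> x [Sx [_ [_ eu]]] [Cx Mx] ex.
  under eq_bigr => i _ do rewrite ffunE.
  rewrite Sx -{1}(coordinatesK (gval r x) eu); apply: eq_bigr => i _.
  by rewrite Mx Cx ex (CP i).2 mul_scalar_mx.
move=> d [dc rE]; apply/ffunP => i; rewrite ffunE; apply: gval_inj.
have GD : \forall x \near G, forall i, exists t, gval (d i) x = t%:M.
  by apply: filter_forall => j; exact: center_gval.
have GM : \forall x \near G, forall i : 'I_(n ^ 2),
    gval (d i * rmaps (e i)) x = gval (d i) x *m gval (rmaps (e i)) x.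
  by apply: filter_forall => j; exact: gvalM.
have := gval_sum (fun i : 'I_(n ^ 2) => d i * rmaps (e i)); rewrite -rE => GS.
apply: filterS3 (filterI GS GW) (filterI GD GM)
  (filterI gval_rmaps_family (gval_rmaps (C i))).
move=> x [Sx [_ [_ eu]]] [/choice[t tP] Mx] [ex Cx].
rewrite Cx tP (CP i).2; congr _%:M.
apply: (value_mx_inj eu (c := c ^~ x) (d := t)).
rewrite coordinatesK // -[LHS]/(gval r x) Sx; apply: eq_bigr => j _.
by rewrite Mx tP ex mul_scalar_mx.
Qed.

End Basis.
End GenericValues.

(** * Central simplicity and generic bases *)

Lemma delta_mxM (k : fieldType) n (M : 'M[k]_n) (a i j b : 'I_n) :
  delta_mx a i *m (M *m delta_mx j b) = M i j *: delta_mx a b.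
Proof.
have E : row i M *m delta_mx j 0 = (M i j)%:M :> 'M_1.
  by rewrite -colE; apply/matrixP => s t; rewrite !ord1 !mxE.
rewrite -(mul_delta_mx (0 : 'I_1) a i) -(mul_delta_mx (0 : 'I_1) j b) !mulmxA.
rewrite -[_ *m delta_mx 0 i *m M]mulmxA -rowE -[_ *m row i M *m _]mulmxA E.
by rewrite mul_mx_scalar -scalemxAl mul_delta_mx.
Qed.

Section CentralSimple.
Variables (k : fieldType) (n : nat) (X : PGLvariety k n).
Hypothesis n_gt0 : (0 < n)%N.
Hypothesis irrX : irreducible X.
Local Notation G := (@generically X).
Let G_proper : ProperFilter G := generically_proper irrX.
#[local] Existing Instance G_proper.

Lemma scalar_mx_eq0 (c : k) : c%:M = 0 :> 'M[k]_n -> c = 0.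
Proof.
by move=> /matrixP/(_ (Ordinal n_gt0) (Ordinal n_gt0)); rewrite !mxE eqxx.
Qed.

Lemma subalgebra_basis (S : set 'M[k]_n) (e : 'I_(n * n) -> X -> 'M[k]_n) x :
  subalgebra S -> value_mx e x \in unitmx -> (forall i, S (e i x)) -> S = setT.
Proof.
move=> [S1 SD _] eu Se; apply/seteqP; split=> // M _.
have S0 : S 0 by have := SD (-1) _ _ S1 S1; rewrite scaleN1r addNr.
rewrite -(coordinatesK M eu); apply: big_ind => // [A B SA SB|i _].
  by rewrite -[A]scale1r; exact: SD.
by rewrite -[X in S X]addr0; apply: SD.
Qed.

Definition attained_values (x : X) : set 'M[k]_n :=
  [set M | exists phi : eqrmap X, rdom phi x /\ mval phi x = M].

Lemma attained_values_subalgebra x : subalgebra (attained_values x).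
Proof.
split.
- by exists (eqrmap_cst X (@one_conj k n)).
- move=> a _ _ [phi [px <-]] [psi [qx <-]].
  exists (eqrmap_op (@add_morphism k n X) (@add_conj k n)
    (eqrmap_op (@mul_morphism k n X) (@mul_conj k n)
      (eqrmap_cst X (fun g : PGL k n => pgl_conj_scalar g a)) phi) psi).
  split=> //.
  by rewrite /mval /= mul_scalar_mx.
- move=> _ _ [phi [px <-]] [psi [qx <-]].
  by exists (eqrmap_op (@mul_morphism k n X) (@mul_conj k n) phi psi).
Qed.

Lemma attained_values_basis (e : 'I_(n * n) -> eqrmap X) x :
  (forall i, rdom (e i) x) -> value_mx (fun i => mval (e i)) x \in unitmx ->
  attained_values x = setT.
Proof.
move=> ex eu; apply: subalgebra_basis (attained_values_subalgebra x) eu _ => i.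
by exists (e i).
Qed.

Lemma basis_generic (e : 'I_(n * n) -> eqrmap X) x :
  (forall i, rdom (e i) x) -> value_mx (fun i => mval (e i)) x \in unitmx ->
  \forall y \near G, value_mx (fun i => mval (e i)) y \in unitmx.
Proof.
move=> ex eu; apply: (@near_generically _ x); apply: mx_regular_at_unit => //.
by apply: value_mx_regular => i; exact: mval_regular.
Qed.

(** The basis is indexed through mxvec, which makes the matrix of its values at
    x the identity. P is membership in an ideal in the main application. *)
Lemma matrix_units_basis (P : eqrmap X -> Prop) x :
  (forall a b, exists phi,
     [/\ P phi, rdom phi x & mval phi x = delta_mx a b]) ->
  exists e : 'I_(n * n) -> eqrmap X, [/\ forall i, P (e i),
    forall i, rdom (e i) x & value_mx (fun i => mval (e i)) x \in unitmx].
Proof.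
move=> Pab; have /choice[e eP] (i : 'I_(n * n)) : exists phi,
    [/\ P phi, rdom phi x & mval phi x = vec_mx (delta_mx 0 i)].
  by case/mxvec_indexP: i => a b; rewrite vec_mx_delta; exact: Pab.
exists e; split; try by move=> i; have [] := eP i.
rewrite (_ : value_mx _ x = 1%:M) ?unitmx1 //.
apply/row_matrixP => i; rewrite rowK row1.
by have [_ _ ->] := eP i; rewrite vec_mxK.
Qed.

(** For simplicity let r be a nonzero element of an ideal and y a general point
    with r(y) != 0. Multiplying r on both sides by maps that take suitable
    values at y gives elements of the ideal that take the matrix units as
    values at y. They form a basis over the centre, so 1 is a combination of
    them. *)
Lemma attained_values_central_simple x :
  attained_values x = setT -> central_simple_of_degree (RMaps X) n.
Proof.
move=> vT.
have [|e [_ ex eu]] := @matrix_units_basis (fun _ => True) x.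
  move=> a b; have : attained_values x (delta_mx a b) by rewrite vT.
  by move=> [phi [? ?]]; exists phi.
have Gu := basis_generic ex eu.
split; last by exists (fun i => rmaps (e i)); exact: basis_of_generic_basis.
split.
  apply/eqP => E; have [y []] := filter_ex (filterI (gval0 irrX) (gval1 irrX)).
  by rewrite E => -> /esym/scalar_mx_eq0/eqP; rewrite oner_eq0.
move=> I [I0 ID Il Ir].
have [[r [Ir' r0]]|I0'] := pselect (exists r, I r /\ r != 0).
  right.
  have [y [[ey uy] [ry ry0]]] : exists y, ((forall i, rdom (e i) y) /\
      value_mx (fun i => mval (e i)) y \in unitmx) /\
      (rdom (rmaps_repr r) y /\ gval r y != 0).
    apply: contrapT => H; move/eqP: r0; apply; apply: gval_inj => //.
    apply: filterS3 (filterI (rdoms_generic irrX e) Gu)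
      (rdom_generic irrX (rmaps_repr r)) (gval0 irrX) => y [ey uy] ry ->.
    by apply/eqP/negPn/negP => ry0; apply: H; exists y.
  have vy := attained_values_basis ey uy.
  have /existsP[i /existsP[j rij]] : [exists i, exists j, gval r y i j != 0].
    apply: contraR ry0 => /existsPn H; apply/eqP/matrixP => i j.
    by have /existsPn/(_ j) := H i; rewrite negbK mxE => /eqP.
  pose emul := eqrmap_op (@mul_morphism k n X) (@mul_conj k n).
  have [|u [Iu uy' uu]] := @matrix_units_basis (fun phi => I (rmaps phi)) y.
    move=> a b.
    have : attained_values y ((gval r y i j)^-1 *: delta_mx a i) by rewrite vy.
    move=> [phi [py pE]].
    have : attained_values y (delta_mx j b) by rewrite vy.
    move=> [psi [qy qE]].
    exists (emul phi (emul (rmaps_repr r) psi)); split=> //.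
      rewrite -[rmaps _]/(rmaps (emul _ _)) -rmaps_opE.
      apply: Il; rewrite -rmaps_opE rmaps_reprK.
      exact: Ir.
    rewrite -[LHS]/(mval phi y *m (gval r y *m mval psi y)) pE qE.
    by rewrite -scalemxAl delta_mxM scalerA mulVf // scale1r.
  have [c [[_ E] _]] :=
    basis_of_generic_basis irrX n_gt0 (basis_generic uy' uu) 1.
  have I1 : I 1.
    by rewrite E; apply: big_ind => // l _; apply: Il; exact: Iu.
  by apply/seteqP; split=> // s _; rewrite -[s]mulr1; exact: Il.
left; apply/seteqP; split=> [r Irr|_ -> //].
by apply/eqP/negPn/negP => r0; apply: I0'; exists r.
Qed.

(** Multiplying by values of u, on either side, is linear over k. *)
Lemma mulop_relations (I : finType) (a : I -> RMaps X) T : mulop T ->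
  \forall x \near G, forall c : I -> k,
    \sum_i c i *: gval (a i) x = 0 -> \sum_i c i *: gval (T (a i)) x = 0.
Proof.
elim=> [|u S _ IH|u S _ IH|S1 S2 _ IH1 _ IH2].
- by apply: filterE.
- have H : \forall x \near G, forall i,
      gval (u * S (a i)) x = gval u x *m gval (S (a i)) x.
    by apply: filter_forall => i; exact: gvalM.
  apply: filterS2 H IH => x H IH c /IH E.
  transitivity (gval u x *m \sum_i c i *: gval (S (a i)) x).
    by rewrite mulmx_sumr; apply: eq_bigr => i _; rewrite H scalemxAr.
  by rewrite E mulmx0.
- have H : \forall x \near G, forall i,
      gval (S (a i) * u) x = gval (S (a i)) x *m gval u x.
    by apply: filter_forall => i; exact: gvalM.
  apply: filterS2 H IH => x H IH c /IH E.
  transitivity ((\sum_i c i *: gval (S (a i)) x) *m gval u x).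
    by rewrite mulmx_suml; apply: eq_bigr => i _; rewrite H scalemxAl.
  by rewrite E mul0mx.
- have H : \forall x \near G, forall i,
      gval (S1 (a i) + S2 (a i)) x = gval (S1 (a i)) x + gval (S2 (a i)) x.
    by apply: filter_forall => i; exact: gvalD.
  apply: filterS3 H IH1 IH2 => x H IH1 IH2 c E.
  rewrite -[RHS]addr0 -[X in _ = X + _](IH1 c E) -[X in _ = _ + X](IH2 c E).
  by rewrite -big_split /=; apply: eq_bigr => i _; rewrite H scalerDr.
Qed.

(** The values of a basis b over the centre are linearly independent at
    a general point x: the operator dual to b_j carries a linear relation
    sum_i c_i b_i(x) = 0 to c_j = 0. Independence over the centre
    alone would not suffice, as the c_i are scalars and the centre is not
    known beforehand to consist of scalar matrices. *)
Lemma central_simple_generic_basis : central_simple_of_degree (RMaps X) n ->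
  exists e : 'I_(n * n) -> eqrmap X,
    \forall x \near G, value_mx (fun i => mval (e i)) x \in unitmx.
Proof.
move=> [simpleA [b bP]]; pose a i := if insub i is Some j then b j else 0.
have aE (i : 'I_(n ^ 2)) : a i = b i by rewrite /a valK.
have [c cc ca|T [mT Ta]] := @artin_whaples _ simpleA (n ^ 2)%N a.
  have center0 : center (0 : RMaps X) by move=> r; rewrite mul0r mulr0.
  move=> i ilt; have [d [_ duniq]] := bP 0.
  have d0 : d = [ffun _ => 0].
    apply: duniq; split=> [j|]; first by rewrite ffunE.
    by rewrite big1 // => j _; rewrite ffunE mul0r.
  have dc : d = [ffun j : 'I_(n ^ 2) => c j].
    apply: duniq; split=> [j|]; first by rewrite ffunE.
    by rewrite -[LHS]ca; apply: eq_bigr => j _; rewrite ffunE aE.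
  by move: d0; rewrite dc => /ffunP/(_ (Ordinal ilt)); rewrite !ffunE.
exists (fun i => rmaps_repr (b i)).
have rel : \forall x \near G, forall (j : 'I_(n ^ 2)) (c : 'I_(n ^ 2) -> k),
    \sum_i c i *: gval (b i) x = 0 -> \sum_i c i *: gval (T j (b i)) x = 0.
  by apply: filter_forall => j; apply: mulop_relations; exact: mT.
have delta : \forall x \near G, forall (p : 'I_(n ^ 2) * 'I_(n ^ 2)),
    gval (T p.2 (b p.1)) x = ((p.1 == p.2)%:R)%:M.
  apply: filter_forall => -[i j]; rewrite -aE Ta //= -val_eqE /=.
  case: (nat_of_ord i == nat_of_ord j); last first.
    by apply: filterS (gval0 irrX) => x x0; rewrite [RHS]raddf0; exact: x0.
  exact: gval1.
apply: filterS2 rel delta => x rel delta.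
rewrite -row_free_unit; apply: inj_row_free => v.
rewrite mul_value_mx => /(canRL mxvecK); rewrite linear0 => E.
apply/rowP => j; rewrite mxE; apply: scalar_mx_eq0.
have := rel j (v 0) E; rewrite (bigD1 j) //= big1 => [|i /negPf ij].
  by rewrite (delta (j, j)) /= eqxx addr0 scalemx1.
by rewrite (delta (i, j)) /= ij raddf0 scaler0.
Qed.

Lemma basis_stabilizer (e : 'I_(n * n) -> eqrmap X) x g :
  (forall i, rdom (e i) x) -> value_mx (fun i => mval (e i)) x \in unitmx ->
  (forall i, pgl_conj g (mval (e i) x) = mval (e i) x) -> g = 1%g.
Proof.
move=> ex eu ge.
have [|c cE] := @central_mx_scalar k n (gl_mx (pgl_repr g)) n_gt0.
  move=> N; rewrite -(coordinatesK N eu) mulmx_sumr mulmx_suml.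
  apply: eq_bigr => i _; rewrite -scalemxAr -scalemxAl.
  by rewrite (pgl_conj_comm (ge i)).
rewrite -(pgl_reprK g) -[RHS]/(pgl (gl_one k n)); apply/eq_pgl/asboolP.
exists c; last by rewrite cE -[RHS]/(c *: 1%:M) scalemx1.
apply/eqP => c0; have := gl_mx_unit (pgl_repr g).
rewrite cE c0 raddf0 => u0; have : (0 : 'M[k]_n) = 1%:M.
  by rewrite -(mulmxV u0) mul0mx.
by move=> /esym/scalar_mx_eq0/eqP; rewrite oner_eq0.
Qed.

Lemma generic_basis_free (e : 'I_(n * n) -> eqrmap X) :
  (\forall x \near G, value_mx (fun i => mval (e i)) x \in unitmx) ->
  generically_free X.
Proof.
move=> eu; have [W [oW dW W0 WP]] :=
  generic_point_open irrX (filterI eu (rdoms_generic irrX e)).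
exists W; split=> // x /WP[ux ex] g gx; apply: (basis_stabilizer ex ux) => i.
by rewrite -(@mval_equivariant _ _ _ (e i) g x) ?gx.
Qed.

End CentralSimple.

(** * Invariants from the span of an orbit *)

Section OrbitSpan.
Variables (k : fieldType) (n : nat) (X : PGLvariety k n) (p : nat).
Variables (V W : set X) (v : X -> 'rV[k]_p).
Hypotheses (oV : open V) (oW : open W) (W0 : W !=set0).
Hypothesis rv : forall x, V x -> mx_regular_at x v.

Local Notation translates r s x := (\matrix_(i < r) v (gact (s i) x)).

(** Take translates v(s_1 x), ..., v(s_r x) that are linearly independent at
    some point, with r as large as possible. Near that point they are a basis
    of the span of v over the part of the orbit of x in V. This span is the
    same for x and gx. Its basis R(x) normalized by R(x) S = 1, for a fixed
    right inverse S of the matrix of translates at the given point, is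
    determined by the span, so it is invariant. *)
Lemma orbit_span_invariants :
  exists (r : nat) (U : set X) (R : X -> 'M[k]_(r, p)),
  [/\ [/\ open U, U !=set0 & U `<=` W], forall x, U x -> mx_regular_at x R,
      forall g x, U x -> U (gact g x) -> R (gact g x) = R x,
      forall g x, U x -> V (gact g x) -> (v (gact g x) <= R x)%MS &
      forall x (d : 'cV[k]_p), U x ->
        (forall g, V (gact g x) -> v (gact g x) *m d = 0) -> R x *m d = 0].
Proof.
pose P r := `[< exists x (s : 'I_r -> PGL k n), [/\ W x,
  forall i, V (gact (s i) x) & row_free (translates r s x)] >].
have P0 : exists r, P r.
  have [x Wx] := W0; exists 0; apply/asboolP; exists x, (fun _ => 1%g).
  split=> //; first by case.
  by rewrite /row_free flatmx0 mxrank0.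
have Pp r : P r -> (r <= p)%N.
  by move=> /asboolP[x [s [_ _ /eqP <-]]]; exact: rank_leq_col.
case: (ex_maxnP P0 Pp) => r /asboolP[x1 [s [Wx1 sx1 fx1]]] rmax.
pose B x : 'M[k]_(r, p) := translates r s x.
have [S BS] := row_freeP fx1.
pose U := [set x | [/\ W x, forall i, V (gact (s i) x) & B x *m S \in unitmx]].
have rB x : (forall i, V (gact (s i) x)) -> mx_regular_at x B.
  move=> sx i j; have [_ rg] := gact_morphism_l (s i) x.
  apply: regular_at_ext (rg _ (rv (sx i) 0 j)) => y.
  by rewrite /B mxE.
have rBS x : (forall i, V (gact (s i) x)) ->
    mx_regular_at x (fun y => B y *m S).
  move=> sx; apply: mx_regular_at_mul; first exact: rB.
  by move=> i j; exact: regular_at_cst.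
have freeB x : U x -> row_free (B x).
  move=> [_ _ u]; apply/row_freeP; exists (S *m invmx (B x *m S)).
  by rewrite mulmxA mulmxV.
have spanB g x : U x -> V (gact g x) -> (v (gact g x) <= B x)%MS.
  move=> Ux Vgx; have [Wx sx _] := Ux; apply/negPn/negP => vB.
  pose s' (i : 'I_(1 + r)) :=
    match fintype.split i with inl _ => g | inr j => s j end.
  have : P (1 + r)%N.
    apply/asboolP; exists x, s'; split=> //.
      by move=> i; rewrite /s'; case: (fintype.split i).
    rewrite (_ : translates _ _ _ = col_mx (v (gact g x)) (B x)); last first.
      apply/row_matrixP => i; rewrite rowK /s'.
      case: (split_ordP i) => j ->; first by rewrite ord1 rowKu row_id.
      by rewrite rowKd rowK.
    apply: inj_row_free => w; rewrite -[w]hsubmxK mul_row_col => E.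
    have [w0|w0] := eqVneq (lsubmx w) 0.
      move: E; rewrite w0 mul0mx add0r => /eqP.
      by rewrite mulmx_free_eq0 ?freeB // => /eqP ->; rewrite row_mx0.
    case/negP: vB; have w00 : lsubmx w 0 0 != 0.
      by apply: contra w0 => /eqP w0; apply/eqP/rowP => i; rewrite ord1 w0 mxE.
    move: E; rewrite [lsubmx w]mx11_scalar mul_scalar_mx => /eqP.
    rewrite addr_eq0 -(inj_eq (scalerI (invr_neq0 w00))).
    rewrite scalerA mulVf // scale1r => /eqP ->.
    by rewrite scalerN -scaleNr scalemxAl submxMl.
  by move/rmax; rewrite ltnn.
pose R x := invmx (B x *m S) *m B x.
have RS x : U x -> R x *m S = 1%:M.
  by move=> [_ _ u]; rewrite /R -mulmxA mulVmx.
have BR x : U x -> (B x <= R x)%MS.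
  by move=> [_ _ u]; rewrite -[X in (X <= _)%MS](mulKVmx u) submxMl.
exists r, U, R; split=> [||g x Ux Ugx|g x Ux Vgx|x d Ux vd].
- split; last by move=> x [].
    rewrite openE => x [Wx sx u].
    have nW : \forall y \near x, W y by apply: open_nbhs_nbhs.
    have nV : \forall y \near x, forall i, V (gact (s i) y).
      apply: filter_forall => i; have [cg _] := gact_morphism_l (s i) x.
      by apply: cg; apply: open_nbhs_nbhs.
    by apply: filterS3 nW nV (mx_regular_at_unit (rBS x sx) u) => y.
  by exists x1; split=> //; rewrite /B BS unitmx1.
- move=> x [Wx sx u]; apply: mx_regular_at_mul; last exact: rB.
  by apply: mx_regular_at_inv => //; exact: rBS.
- have : (R (gact g x) <= R x)%MS.
    apply: submx_trans (BR x Ux); rewrite /R (submx_trans (submxMl _ _)) //.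
    apply/row_subP => i; rewrite rowK -gactM; apply: spanB => //.
    by rewrite gactM; have [_ /(_ i)] := Ugx.
  move=> /submxP[M ME]; have := RS _ Ugx; rewrite ME -mulmxA RS // mulmx1 => M1.
  by rewrite M1 mul1mx.
- exact: submx_trans (spanB g x Ux Vgx) (BR x Ux).
- rewrite /R -mulmxA (_ : B x *m d = 0) ?mulmx0 //.
  apply/row_matrixP => i; rewrite row_mul rowK row0; apply: vd.
  by have [_ /(_ i)] := Ux.
Qed.

End OrbitSpan.

(** * Regular functions on the projective linear group *)

Section RegularFunctionsOnPGL.
Import -(notations) mpoly.
Variables (k : fieldType) (n : nat).

Lemma gl_nbhs_poly (N : set (@GL k n)) : nbhs (gl_one k n) N ->
  exists2 q, polyfun q (1%:M : 'M[k]_n) != 0 &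
    forall A : @GL k n, polyfun q (gl_mx A) != 0 -> N A.
Proof.
rewrite nbhsE => -[O [[C oC CO] O1] ON].
have /zariski_nbhsP[q q1 qC] : nbhs (1%:M : zariski 'M[k]_n) C.
  apply: open_nbhs_nbhs; split=> //.
  by rewrite -[C _]/((set_val @^-1` C) (gl_one k n)) CO.
by exists q => // A /qC CA; apply: ON; rewrite -CO.
Qed.

Lemma pgl_nbhs_poly (U : set (PGL k n)) : nbhs (1%g : PGL k n) U ->
  exists2 q, polyfun q (1%:M : 'M[k]_n) != 0 &
    forall A : @GL k n, polyfun q (gl_mx A) != 0 -> U (pgl A).
Proof.
move=> U1; apply: (@gl_nbhs_poly [set A | U (pgl A)]).
exact: (@pi_continuous _ {eq_quot (@proportional k n)} (gl_one k n) U U1).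
Qed.

(** Regular functions on PGL are those whose pullbacks to the open subset GL of
    the affine space of matrices are regular. *)
Lemma pgl_regular_poly (f : PGL k n -> k) : regular_at (1%g : PGL k n) f ->
  exists P Q q, [/\ polyfun q (1%:M : 'M[k]_n) != 0,
    polyfun Q (1%:M : 'M[k]_n) != 0 &
    forall A : @GL k n, polyfun q (gl_mx A) != 0 ->
      f (pgl A) = polyfun P (gl_mx A) / polyfun Q (gl_mx A)].
Proof.
move=> /nbhs_singleton/(_ (gl_one k n) erefl)[g [P [Q [Q1 gE]]] fg].
have [q q1 qg] := gl_nbhs_poly fg.
have /zariski_nbhsP[r r1 rg] := gE.
exists P, Q, (q * r); split=> //; first by rewrite /polyfun mevalM mulf_neq0.
move=> A; rewrite /polyfun mevalM mulf_eq0 negb_or => /andP[/qg fA /rg gA].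
by rewrite -[f _]/((f \o @pgl k n) A) fA gA.
Qed.

End RegularFunctionsOnPGL.

(** * Separation of variables *)

Section Separable.
Import -(notations) mpoly.
Variables (k : fieldType) (n : nat) (X : PGLvariety k n) (M : set (X -> k)).
Hypothesis M_cst : forall c : k, M (fun _ => c).
Hypothesis M_mul : forall f g, M f -> M g -> M (fun y => f y * g y).

(** Sums of products of an arbitrary function of x and a function of y in the
    class M. Only the finiteness of the set of functions of y
    matters, since it bounds the dimension of the space in which orbits are
    compared. *)
Definition separable (F : X -> X -> k) : Prop :=
  exists (J : finType) (c m : J -> X -> k), (forall j, M (m j)) /\
    forall x y, F x y = \sum_j c j x * m j y.

Lemma separable_ext F F' : (forall x y, F x y = F' x y) ->
  separable F -> separable F'.
Proof.
by move=> FF' [J [c [m [Mm E]]]]; exists J, c, m; split=> // x y; rewrite -FF'.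
Qed.

Lemma separable_l (c : X -> k) : separable (fun x _ => c x).
Proof.
exists unit, (fun _ => c), (fun _ _ => 1); split=> [_|x y]; first exact: M_cst.
by rewrite big_const card_unit /= mulr1 addr0.
Qed.

Lemma separable_r (m : X -> k) : M m -> separable (fun _ y => m y).
Proof.
exists unit, (fun _ _ => 1), (fun _ => m); split=> // x y.
by rewrite big_const card_unit /= mul1r addr0.
Qed.

Lemma separable_add F F' :
  separable F -> separable F' -> separable (fun x y => F x y + F' x y).
Proof.
move=> [J [c [m [Mm E]]]] [J' [c' [m' [Mm' E']]]].
exists (J + J')%type, (fun i => match i with inl j => c j | inr j => c' j end),
  (fun i => match i with inl j => m j | inr j => m' j end); split.
  by case.
by move=> x y; rewrite E E' big_sumType.
Qed.

Lemma separable_mul F F' :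
  separable F -> separable F' -> separable (fun x y => F x y * F' x y).
Proof.
move=> [J [c [m [Mm E]]]] [J' [c' [m' [Mm' E']]]].
exists (J * J')%type, (fun i x => c i.1 x * c' i.2 x),
  (fun i y => m i.1 y * m' i.2 y); split; first by move=> i; exact: M_mul.
move=> x y; rewrite E E' big_distrl /=.
under eq_bigr => i _ do rewrite big_distrr /=.
by rewrite pair_big; apply: eq_bigr => -[i j] _ /=; rewrite mulrACA.
Qed.

Lemma separable_sum (I : Type) (s : seq I) (F : I -> X -> X -> k) :
  (forall i, separable (F i)) -> separable (fun x y => \sum_(i <- s) F i x y).
Proof.
move=> sF; elim: s => [|i s IH].
  by apply: separable_ext (separable_l (fun _ => 0)) => x y; rewrite big_nil.
by apply: separable_ext (separable_add (sF i) IH) => x y; rewrite big_cons.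
Qed.

Lemma separable_prod (I : Type) (s : seq I) (F : I -> X -> X -> k) :
  (forall i, separable (F i)) -> separable (fun x y => \prod_(i <- s) F i x y).
Proof.
move=> sF; elim: s => [|i s IH].
  by apply: separable_ext (separable_l (fun _ => 1)) => x y; rewrite big_nil.
by apply: separable_ext (separable_mul (sF i) IH) => x y; rewrite big_cons.
Qed.

Section Matrices.
Variable A : X -> X -> 'M[k]_n.
Hypothesis sA : forall i j, separable (fun x y => A x y i j).

Lemma separable_det : separable (fun x y => \det (A x y)).
Proof.
apply: separable_sum => s; apply: separable_mul.
  exact: (separable_l (fun _ => _)).
by apply: separable_prod => i.
Qed.

Lemma separable_polyfun p : separable (fun x y => polyfun p (A x y)).
Proof.
have sc i : separable (fun x y => coord (vbasis {:'M[k]_n}) i (A x y)).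
  apply: (@separable_ext (fun x y => \sum_a \sum_b
      coord (vbasis {:'M[k]_n}) i (delta_mx a b) * A x y a b)).
    move=> x y; rewrite [in RHS](matrix_sum_delta (A x y)) linear_sum.
    apply: eq_bigr => a _; rewrite linear_sum; apply: eq_bigr => b _.
    by rewrite linearZ mulrC.
  apply: separable_sum => a; apply: separable_sum => b.
  by apply: separable_mul => //; exact: separable_l.
apply: (@separable_ext (fun x y => \sum_(m <- msupp p) mcoeff m p *
    \prod_i \prod_(j < mpoly.fun_of_multinom m i)
      coord (vbasis {:'M[k]_n}) i (A x y))).
  move=> x y; rewrite /polyfun mevalE; apply: eq_bigr => m _.
  by congr (_ * _); apply: eq_bigr => i _; rewrite prodr_const card_ord.
apply: separable_sum => m; apply: separable_mul; first exact: separable_l.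
by apply: separable_prod => i; apply: separable_prod => j; exact: sc.
Qed.

End Matrices.
End Separable.

(** * Regular functions along orbits *)

Section Transport.
Variables (k : fieldType) (n : nat) (X : PGLvariety k n).
Hypothesis n_gt0 : (0 < n)%N.
Variable e : 'I_(n * n) -> eqrmap X.
Local Notation emx := (value_mx (fun i => mval (e i))).
Let o : 'I_n := Ordinal n_gt0.

Definition basis_locus : set X :=
  [set x | (forall i, rdom (e i) x) /\ emx x \in unitmx].

(** Regular functions that factor through the tuple of values of e: they do not
    see the difference between points at which e takes the same values. *)
Definition value_function : set (X -> k) :=
  [set m | (forall y, (forall i, rdom (e i) y) -> regular_at y m) /\
    (forall y y', (forall i, mval (e i) y = mval (e i) y') -> m y = m y')].

Lemma value_function_cst c : value_function (fun _ => c).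
Proof. by split=> // y _; exact: regular_at_cst. Qed.

Lemma value_function_mul f g :
  value_function f -> value_function g -> value_function (fun y => f y * g y).
Proof.
move=> [rf Ef] [rg Eg]; split=> [y ey|y y' E].
  by apply: regular_at_mul; [exact: rf|exact: rg].
by rewrite (Ef y y') // (Eg y y').
Qed.

Let sepl := separable_l value_function_cst.
Let sepM := separable_mul value_function_mul.

(** If y = gx and A represents g, then the linear map that sends e_l(x) to
    e_l(y) is conjugation by A. Its value on the matrix unit E_(c,o) is
    A E_(c,o) A^-1, whose column o is (A^-1)_(o,o) times column c of A. So
    these columns together are a multiple of A, and they are linear in the
    values e_l(y). *)
Definition transport (x y : X) : 'M[k]_n :=
  \matrix_(a, c) (\sum_l
    coordinates (fun i => mval (e i)) x (delta_mx c o) 0 l *: mval (e l) y) a o.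

Lemma transport_separable a c :
  separable value_function (fun x y => transport x y a c).
Proof.
apply: (@separable_ext _ _ _ _ (fun x y =>
  \sum_l coordinates (fun i => mval (e i)) x (delta_mx c o) 0 l *
         mval (e l) y a o)).
  move=> x y; rewrite [RHS]mxE summxE; apply: eq_bigr => l _.
  by rewrite [RHS]mxE.
apply: separable_sum; first exact: value_function_cst.
move=> l; apply: sepM; first exact: sepl.
apply: separable_r; split=> [y ey|y y' E]; last by rewrite E.
by apply: mval_regular; exact: ey.
Qed.

Lemma transport_poly_separable p :
  separable value_function (fun x y => polyfun p (transport x y)).
Proof.
exact: (separable_polyfun value_function_cst value_function_mul
  transport_separable).
Qed.

Lemma transport_det_poly_separable p : separable value_function
  (fun x y => \det (transport x y) * polyfun p (transport x y)).
Proof.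
apply: sepM; first exact: (separable_det value_function_cst value_function_mul
    transport_separable).
exact: transport_poly_separable.
Qed.

Lemma transport1 x : basis_locus x -> transport x x = 1%:M.
Proof.
move=> [ex ux]; apply/matrixP => a c; rewrite mxE coordinatesK // !mxE.
by rewrite eqxx andbT.
Qed.

Lemma transportE x (A : @GL k n) : basis_locus x ->
  (forall i, rdom (e i) (gact (pgl A) x)) ->
  transport x (gact (pgl A) x) = invmx (gl_mx A) o o *: gl_mx A.
Proof.
move=> [ex ux] egx; apply/matrixP => a c; rewrite mxE.
under eq_bigr => l _ do rewrite mval_equivariant //.
rewrite -pgl_conj_sum coordinatesK // pgl_conjE [RHS]mxE mulrC.
rewrite -(mul_delta_mx (0 : 'I_1)) mulmxA -mulmxA -colE -rowE.
by rewrite mxE big_ord1 !mxE.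
Qed.

(** The factor of A in [transportE] may vanish, but not if the product is
    invertible. *)
Lemma transport_pgl x g : basis_locus x -> (forall i, rdom (e i) (gact g x)) ->
  transport x (gact g x) \in unitmx ->
  exists2 B : @GL k n, gl_mx B = transport x (gact g x) & pgl B = g.
Proof.
move=> gx egx u; exists (to_gl u) => //.
rewrite -{2}(pgl_reprK g); apply/eq_pgl/asboolP.
have := @transportE x (pgl_repr g) gx; rewrite pgl_reprK => /(_ egx) E.
exists (invmx (gl_mx (pgl_repr g)) o o); last exact: E.
apply/eqP => c0; move: u; rewrite E c0 scale0r unitmxE.
case: (n) n_gt0 => // n' _.
by rewrite det0 unitr0.
Qed.

(** Functions of (g, x) that can be written as fractions in terms of x and
    y = gx. The denominator is nonzero on the diagonal y = x, but it may
    vanish elsewhere, and then nothing is claimed. *)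
Definition separable_fraction (F : PGL k n -> X -> k) : Prop :=
  exists N E : X -> X -> k, [/\ separable value_function N,
    separable value_function E,
    forall x, basis_locus x -> E x x != 0 &
    forall x g, basis_locus x -> (forall i, rdom (e i) (gact g x)) ->
      E x (gact g x) != 0 -> F g x = N x (gact g x) / E x (gact g x)].

Lemma fraction_mul F F' : separable_fraction F -> separable_fraction F' ->
  separable_fraction (fun g x => F g x * F' g x).
Proof.
move=> [N [E [sN sE E1 FE]]] [N' [E' [sN' sE' E1' FE']]].
exists (fun x y => N x y * N' x y), (fun x y => E x y * E' x y); split.
- exact: sepM.
- exact: sepM.
- by move=> x gx; rewrite mulf_neq0 ?E1 ?E1'.
- move=> x g gx egx; rewrite mulf_eq0 negb_or => /andP[? ?].
  by rewrite FE // FE' // mulf_div.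
Qed.

Lemma fraction_add F F' : separable_fraction F -> separable_fraction F' ->
  separable_fraction (fun g x => F g x + F' g x).
Proof.
move=> [N [E [sN sE E1 FE]]] [N' [E' [sN' sE' E1' FE']]].
exists (fun x y => N x y * E' x y + N' x y * E x y),
  (fun x y => E x y * E' x y); split.
- by apply: separable_add; exact: sepM.
- exact: sepM.
- by move=> x gx; rewrite mulf_neq0 ?E1 ?E1'.
- move=> x g gx egx; rewrite mulf_eq0 negb_or => /andP[? ?].
  by rewrite FE // FE' // addf_div.
Qed.

Lemma fraction_r (c : X -> k) : separable_fraction (fun _ x => c x).
Proof.
exists (fun x _ => c x), (fun _ _ => 1); split.
- exact: sepl.
- exact: sepl (fun _ => 1).
- by move=> x _; exact: oner_neq0.
- by move=> x g _ _ _; rewrite divr1.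
Qed.

(** A representative of g is a polynomial in the values at y = gx. The factor D
    in numerator and denominator excludes the points at which [transport] is
    not invertible or f is not given by the fraction P / Q. *)
Lemma fraction_l (f : PGL k n -> k) : regular_at (1%g : PGL k n) f ->
  separable_fraction (fun g _ => f g).
Proof.
move=> /pgl_regular_poly[P [Q [q [q1 Q1 fE]]]].
pose D x y := \det (transport x y) * polyfun q (transport x y).
have sD : separable value_function D := transport_det_poly_separable q.
exists (fun x y => D x y * polyfun P (transport x y)),
  (fun x y => D x y * polyfun Q (transport x y)); split.
- by apply: sepM => //; exact: transport_poly_separable.
- by apply: sepM => //; exact: transport_poly_separable.
- by move=> x gx; rewrite /D transport1 // det1 mul1r mulf_neq0.
- move=> x g gx egx; rewrite mulf_eq0 negb_or => /andP[D0 Q0].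
  rewrite -mulf_div divff // mul1r.
  move: D0; rewrite mulf_eq0 negb_or -unitfE -unitmxE => /andP[u q0].
  have [B BE Bg] := transport_pgl gx egx u.
  by rewrite -[in LHS]Bg fE BE.
Qed.

Lemma fraction_teval (t : tensor (PGL k n) X k) (x0 : X) :
  tregular t (1%g : PGL k n, x0) ->
  separable_fraction (fun g x => teval t (g, x)).
Proof.
move=> rt; rewrite /teval; elim: (index_enum _) => [|i s IH].
  have := fraction_r (fun _ => 0); congr separable_fraction.
  by apply/funext => g; apply/funext => x; rewrite big_nil.
have := fraction_add
  (fraction_mul (fraction_l (rt i).1) (fraction_r (tensor_right i))) IH.
congr separable_fraction.
by apply/funext => g; apply/funext => x; rewrite big_cons.
Qed.

(** As the action is a morphism, h(gx) is a fraction of tensors on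
    a neighbourhood of (1, x0), and tensors are separable fractions. The
    factor E vanishes, for x near x0, wherever (g, x) leaves this
    neighbourhood or a denominator vanishes; multiplying by E
    makes the equation hold for all g. *)
Lemma regular_on_orbits (h : X -> k) x0 : basis_locus x0 -> regular_at x0 h ->
  exists D N : X -> X -> k, [/\ separable value_function D,
    separable value_function N &
    \forall x \near x0, basis_locus x -> D x x != 0 /\
      forall g, (forall i, rdom (e i) (gact g x)) ->
        D x (gact g x) * h (gact g x) = N x (gact g x)].
Proof.
move=> gx0 rh; pose z0 : zprod (PGL k n) X := (1%g, x0).
have rh0 : regular_at (gact z0.1 z0.2) h by rewrite gact1.
have [_ /(_ h rh0)[s [t [rs rt t0 hE]]]] := gact_morphism z0.
have [w [U [V [U1 Vx0 rw w0 UVw]]]] := zprod_nbhsP hE.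
have [q q1 qU] := pgl_nbhs_poly U1.
have [Ns [Es [sNs sEs Es1 sE]]] := fraction_teval rs.
have [Nt [Et [sNt sEt Et1 tE]]] := fraction_teval rt.
have [Nw [Ew [sNw sEw Ew1 wE]]] := fraction_teval rw.
pose D x y := \det (transport x y) * polyfun q (transport x y).
have sD : separable value_function D := transport_det_poly_separable q.
(* D takes care of the neighbourhood U of 1 in PGL, Nw of the tensor w that
   defines the neighbourhood of (1, x0) together with U and V. *)
pose E x y := D x y * (Es x y * (Et x y * (Ew x y * (Nw x y * Nt x y)))).
have sE' : separable value_function E by do !apply: sepM => //.
exists (fun x y => E x y * (Nt x y * Es x y)),
  (fun x y => E x y * (Ns x y * Et x y)); split.
- by do !apply: sepM => //.
- by do !apply: sepM => //.
have nt := regular_at_neq0 (teval_regular_r rt) t0.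
have nw := regular_at_neq0 (teval_regular_r rw) w0.
apply: filterS3 Vx0 nt nw => x Vx tx wx gx; split.
  have egx : forall i, rdom (e i) (gact (1%g : PGL k n) x).
    by rewrite gact1; case: gx.
  have := tE x 1%g gx egx; have := wE x 1%g gx egx; rewrite !gact1 => wE1 tE1.
  move: tx wx; rewrite tE1 ?Et1 // wE1 ?Ew1 //.
  rewrite !mulf_eq0 !negb_or => /andP[Nt0 _] /andP[Nw0 _].
  by rewrite /E /D transport1 // det1 oner_eq0 q1 Nt0 Nw0 Es1 ?Et1 ?Ew1.
move=> g egx; have [->|] := eqVneq (E x (gact g x)) 0; first by rewrite !mul0r.
move=> E0; have := E0; rewrite /E mulf_eq0 negb_or => /andP[D0].
rewrite !mulf_eq0 !negb_or => /and5P[Es0 Et0 Ew0 Nw0 Nt0].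
have Ug : U g.
  move: D0; rewrite mulf_eq0 negb_or -unitfE -unitmxE => /andP[u q0].
  have [B BE Bg] := transport_pgl gx egx u.
  by rewrite -Bg; apply: qU; rewrite BE.
have -> : h (gact g x) = teval s (g, x) / teval t (g, x).
  apply: (UVw (g, x)) => //.
  by rewrite wE // mulf_neq0 // invr_eq0.
rewrite sE // tE // -[LHS]mulrA; congr (_ * _).
by rewrite invf_div mulf_div mulrC [Nt _ _ * _]mulrC divfK ?mulf_neq0.
Qed.

End Transport.

(** * Affine charts *)

Section Charts.
Variables (k : fieldType) (X : funSpaceType k).

Lemma open_set_type_regular (C : set X) (oC : open C) (u : C) (f : C -> k)
    (F : X -> k) :
  (forall v : C, F (set_val v) = f v) -> regular_at u f ->
  regular_at (set_val u) F.
Proof.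
move=> Ff [g rg fg]; have : nbhs u [set v | f v = g (set_val v)] by [].
rewrite nbhsE => -[O [[V oV VO] Ou] Og].
have Cu : C (set_val u) by exact: set_mem (valP u).
have Vu : V (set_val u) by rewrite -[V _]/((set_val @^-1` V) u) VO.
have nVC : nbhs (set_val u) (V `&` C).
  by apply: open_nbhs_nbhs; split; [exact: openI|split].
apply: regular_at_eq rg; apply: filterS nVC => x [Vx Cx].
pose v : C := exist (fun x => x \in C) x (mem_set Cx).
have Ov : O v by rewrite -VO.
by rewrite -[x]/(set_val v) Ff; exact/esym/Og.
Qed.

Lemma variety_chart (x0 : X) : variety X ->
  exists (r : nat) (h : 'I_r -> X -> k) (C : set X),
  [/\ open C, C x0, forall i x, C x -> regular_at x (h i) &
      forall x y, C x -> C y -> (forall i, h i x = h i y) -> x = y].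
Proof.
move=> [[I [U [oaU UT]]] _]; have : (\bigcup_i U i) x0 by rewrite UT.
move=> [j _ Ujx0]; have [oU [r [Z [_ [phi [psi [phiK _ mphi _]]]]]]] := oaU j.
pose lift x (Ux : U j x) : U j := exist (fun x => x \in U j) x (mem_set Ux).
pose h i x := match pselect (U j x) with
              | left Ux => (set_val (phi (lift x Ux)) : 'rV[k]_r) 0 i
              | right _ => 0 end.
have hE i (u : U j) : h i (set_val u) = (set_val (phi u) : 'rV[k]_r) 0 i.
  rewrite /h; case: pselect => [Ux|[]]; last exact: set_mem (valP u).
  by congr ((set_val (phi _) : 'rV[k]_r) 0 i); exact: val_inj.
exists r, h, (U j); split=> // [i x Ux|x y Ux Uy hxy].
  have := morphism_at_comp (mphi (lift x Ux)) (@set_val_morphism _ _ _ _).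
  move=> /morphism_matrixP/(_ 0 i).
  by move/(open_set_type_regular oU); apply=> v; rewrite hE.
rewrite -[x]/(set_val (lift x Ux)) -[y]/(set_val (lift y Uy)).
congr set_val; apply: (can_inj phiK); apply: val_inj; apply/rowP => i.
have := hxy i.
by rewrite -[x]/(set_val (lift x Ux)) -[y]/(set_val (lift y Uy)) !hE.
Qed.

End Charts.

(** * Equivariant maps separate generic points *)

Section Separation.
Variables (k : fieldType) (n : nat) (X : PGLvariety k n).
Hypothesis n_gt0 : (0 < n)%N.
Hypothesis irrX : irreducible X.
Local Notation G := (@generically X).
Let G_proper : ProperFilter G := generically_proper irrX.
#[local] Existing Instance G_proper.
Variable e : 'I_(n * n) -> eqrmap X.

Lemma rdom_near (phi : eqrmap X) x :
  rdom phi x -> \forall y \near x, rdom phi y.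
Proof. by move=> dx; apply: open_nbhs_nbhs; split=> //; exact: rdom_open. Qed.

Lemma rdoms_near x : (forall i, rdom (e i) x) ->
  \forall y \near x, forall i, rdom (e i) y.
Proof. by move=> ex; apply: filter_forall => i; exact: rdom_near. Qed.

Lemma basis_locus_near x :
  basis_locus e x -> \forall y \near x, basis_locus e y.
Proof.
move=> [ex ux]; apply: filterS2 (rdoms_near ex) (mx_regular_at_unit _ ux).
  by move=> y; split.
by apply: value_mx_regular => i; exact: mval_regular.
Qed.

(** By [regular_on_orbits], D(x, y) h(y) - N(x, y) = v(y) d(x) for vectors v(y)
    and d(x), so d(x) annihilates v on the orbit of x. The entries of the
    normalized basis R of the span of v are the required invariants: if R
    agrees at x and y, then d(x) annihilates v(y) as well. If moreover e
    agrees at x and y, then D(x, y) = D(x, x) and N(x, y) = N(x, x), and so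
    h(y) = h(x). *)
Lemma separating_invariants (h : X -> k) x0 :
  basis_locus e x0 -> regular_at x0 h ->
  exists (s : seq (eqrmap X)) (U : set X), [/\ open U, U !=set0 &
    forall x y, U x -> U y -> (forall i, mval (e i) x = mval (e i) y) ->
      (forall psi, psi \in s -> mval psi x = mval psi y) -> h x = h y].
Proof.
move=> gx0 rh.
have [D [N [[J [c [m [em DE]]]] [J' [c' [m' [em' NE]]]] Dh]]] :=
  regular_on_orbits n_gt0 gx0 rh.
pose V := [set y | (forall i, rdom (e i) y) /\ regular_at y h].
have oV : open V.
  rewrite openE => y [ey ry].
  by apply: filterS2 (rdoms_near ey) (regular_at_near ry) => z.
have : nbhs x0 [set x |
    (basis_locus e x -> D x x != 0 /\
       forall g, (forall i, rdom (e i) (gact g x)) ->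
       D x (gact g x) * h (gact g x) = N x (gact g x)) /\
    (basis_locus e x /\ regular_at x h)].
  exact: filterI Dh (filterI (basis_locus_near gx0) (regular_at_near rh)).
rewrite nbhsE => -[W [oW Wx0] WP].
pose K : finType := (J + J')%type.
pose v y : 'rV[k]_#|K| := \row_i match enum_val i with
  | inl j => m j y * h y | inr j => m' j y end.
pose d x : 'cV[k]_#|K| := \col_i match enum_val i with
  | inl j => c j x | inr j => - c' j x end.
have vd x y : (v y *m d x) 0 0 = D x y * h y - N x y.
  transitivity (\sum_(i : K) match i with inl j => m j y * h y * c j x
                                     | inr j => - (m' j y * c' j x) end).
    rewrite mxE (reindex (@enum_val K K)) /=; last first.
      by apply: onW_bij; exact: enum_val_bij.
    apply: eq_bigr => i _; rewrite !mxE.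
    by case: (enum_val i) => j; rewrite ?mulrN.
  rewrite big_sumType /= DE NE mulr_suml -sumrN.
  by congr (_ + _); apply: eq_bigr => j _; rewrite mulrC // mulrA.
have rv y : V y -> mx_regular_at y v.
  move=> [ey ry] a b.
  apply: (@regular_at_ext _ _ _ (fun z => match enum_val b with
    | inl j => m j z * h z | inr j => m' j z end)).
    by move=> z; rewrite mxE.
  case: (enum_val b) => j; last exact: (em' j).1.
  by apply: regular_at_mul => //; exact: (em j).1.
have [r [U [R [[oU U0 UW] rR RG vR Rd]]]] :=
  orbit_span_invariants oV oW (ex_intro _ x0 Wx0) rv.
have dU : dense U by exact: open_dense.
have /choice[psi psiP] (p : 'I_r * 'I_#|K|) : exists psi : eqrmap X,
    forall x, mval psi x = (R x p.1 p.2)%:M.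
  have [|g x Ux Ugx|psi _ ?] :=
    @scalar_eqrmap _ _ _ U (fun x => R x p.1 p.2) oU dU.
  - by move=> x Ux; exact: rR.
  - by rewrite RG.
  - by exists psi.
exists (map psi (enum {: 'I_r * 'I_#|K|})), U; split=> // x y Ux Uy exy sxy.
have ER : R x = R y.
  apply/matrixP => i j; have := sxy (psi (i, j)).
  rewrite map_f ?mem_enum // !psiP => /(_ isT)/matrixP.
  by move=> /(_ (Ordinal n_gt0) (Ordinal n_gt0)); rewrite !mxE eqxx.
have [[Dx0 Dxh] [[ex ux] rx]] : (D x x != 0 /\
     forall g, (forall i, rdom (e i) (gact g x)) ->
        D x (gact g x) * h (gact g x) = N x (gact g x)) /\
     basis_locus e x /\ regular_at x h.
  by have [Dx [gx rx]] := WP _ (UW _ Ux); split; first exact: Dx.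
have [_ [[ey _] ry]] := WP _ (UW _ Uy).
have Rdx : R x *m d x = 0.
  apply: Rd => // g [eg _]; apply/matrixP => a b.
  by rewrite !ord1 vd Dxh // subrr mxE.
have : (v y <= R y)%MS.
  by have := @vR 1%g y Uy; rewrite !gact1; apply; split.
rewrite -ER => /submxP[M vM].
have /eqP : (v y *m d x) 0 0 = 0 by rewrite vM -mulmxA Rdx mulmx0 mxE.
rewrite vd subr_eq0 => /eqP Dy.
have Dxy : D x y = D x x.
  by rewrite !DE; apply: eq_bigr => j _; congr (_ * _); exact/esym/(em j).2.
have Nxy : N x y = N x x.
  by rewrite !NE; apply: eq_bigr => j _; congr (_ * _); exact/esym/(em' j).2.
have := Dxh 1%g; rewrite !gact1 => /(_ ex) Dx.
by apply: (mulfI Dx0); rewrite Dx -Nxy -Dy Dxy.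
Qed.

(** Apply [separating_invariants] to the coordinate functions of a chart. *)
Lemma generic_separation : (\forall x \near G,
    value_mx (fun i => mval (e i)) x \in unitmx) ->
  exists (s : seq (eqrmap X)) (U : set X), [/\ open U, U !=set0,
    forall x, U x -> basis_locus e x /\ forall psi, psi \in s -> rdom psi x,
    {subset map e (enum 'I_(n * n)) <= s} &
    forall x y, U x -> U y ->
      (forall psi, psi \in s -> mval psi x = mval psi y) -> x = y].
Proof.
move=> eu; have ggood : \forall x \near G, basis_locus e x.
  by apply: filterS2 (rdoms_generic irrX e) eu => x; split.
have [x1 _] := irrX.1.
have [r [h [C [oC Cx1 rC hC]]]] := variety_chart x1 (gvar_variety X).
have GC : G C by apply: open_generically => //; exists x1.
have [x0 [Cx0 gx0]] := filter_ex (filterI GC ggood).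
have /choice[s sP] i := separating_invariants gx0 (rC i x0 Cx0).
have /choice[U UP] := sP.
pose t := map e (enum 'I_(n * n)) ++ flatten [seq s i | i <- enum 'I_r].
have GU : \forall x \near G, forall i, U i x.
  by apply: filter_forall => i; have [oU U0 _] := UP i; exact: open_generically.
have Gt : \forall x \near G, forall psi, psi \in t -> rdom psi x.
  elim: (t) => [|psi t' IH]; first exact: filterE.
  apply: filterS2 (rdom_generic irrX psi) IH => x px tx chi.
  by rewrite inE => /predU1P[->|/tx].
have [W [oW W0 WP]] := filterI (filterI GC ggood) (filterI GU Gt).
exists t, W; split=> //.
- by move=> x /WP[[_ gx] [_ tx]].
- by move=> psi; rewrite mem_cat => ->.
move=> x y /WP[[Cx _] [Ux _]] /WP[[Cy _] [Uy _]] txy; apply: hC => // i.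
have [_ _] := UP i; apply=> // [j|psi spsi]; apply: txy; rewrite mem_cat.
  by rewrite map_f // mem_enum.
apply/orP; right; apply/flattenP; exists (s i) => //.
by rewrite map_f // mem_enum.
Qed.

End Separation.

(** * Tuples of matrices *)

Section Tuples.
Variables (k : fieldType) (n m : nat).
Local Notation V := {ffun 'I_m -> 'M[k]_n}.

Lemma tuple_morphism (X : funSpaceType k) (F : X -> zariski V) x :
  (forall i, mx_regular_at x (fun y => (F y : V) i)) -> morphism_at F x.
Proof.
move=> rF; apply/morphism_zariskiP => L.
pose D i a b : V := [ffun j => if j == i then delta_mx a b else 0].
apply: (@regular_at_ext _ _ _ (fun y =>
  \sum_i \sum_a \sum_b (F y : V) i a b * L (D i a b))).
  move=> y; rewrite [in RHS](_ : F y =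
    \sum_i \sum_a \sum_b (F y : V) i a b *: D i a b).
    rewrite linear_sum; apply: eq_bigr => i _; rewrite linear_sum.
    apply: eq_bigr => a _; rewrite linear_sum; apply: eq_bigr => b _.
    by rewrite linearZ.
  apply/ffunP => j.
  rewrite sum_ffunE (bigD1 j) //= [X in _ = _ + X]big1 ?addr0 => [|i ij].
    rewrite [LHS]matrix_sum_delta sum_ffunE; apply: eq_bigr => a _.
    rewrite sum_ffunE; apply: eq_bigr => b _.
    by rewrite !ffunE eqxx.
  rewrite sum_ffunE big1 // => a _; rewrite sum_ffunE big1 // => b _.
  by rewrite !ffunE eq_sym (negPf ij) scaler0.
do 3!apply: regular_at_sum => ?.
by apply: regular_at_mul; [exact: rF|exact: regular_at_cst].
Qed.

Lemma tuple_entries_regular (X : funSpaceType k) (F : X -> zariski V) x :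
  morphism_at F x -> forall i, mx_regular_at x (fun y => (F y : V) i).
Proof.
move=> /morphism_zariskiP rF i a b.
have lin : linear (fun v : V => v i a b : k^o).
  by move=> c u v; rewrite !ffunE !mxE.
pose L : {linear V -> k^o} := HB.pack (fun v : V => v i a b : k^o)
  (GRing.isLinear.Build _ _ _ _ (fun v : V => v i a b : k^o) lin).
exact: (rF L).
Qed.

Lemma tuple_conj_morphism (g : PGL k n) :
  morphism (@tuple_conj k n m g : zariski V -> zariski V).
Proof.
move=> v; apply: tuple_morphism => i.
pose A := gl_mx (pgl_repr g).
have rv := tuple_entries_regular (F := id : zariski V -> zariski V) (x := v).
have : mx_regular_at v (fun y : zariski V => A *m (y : V) i *m invmx A).
  apply: mx_regular_at_mul; last by move=> a b; exact: regular_at_cst.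
  apply: mx_regular_at_mul; first by move=> a b; exact: regular_at_cst.
  by apply: rv; split.
by move=> H a b; apply: regular_at_ext (H a b) => y; rewrite ffunE.
Qed.

Lemma generating_conj (g : PGL k n) (v : V) :
  generating v -> generating (tuple_conj g v).
Proof.
move=> gen S [S1 SD SM] Sv; apply/seteqP; split=> // N _.
pose A := gl_mx (pgl_repr g); have uA : A \in unitmx := gl_mx_unit _.
have /(_ (invmx A *m N *m A)) : forall M, S (pgl_conj g M).
  suff : [set M | S (pgl_conj g M)] = setT.
    by move=> E M; rewrite -[S _]/([set M | S (pgl_conj g M)] M) E.
  apply: gen => [|i]; last by have := Sv i; rewrite ffunE.
  split=> [|a B C SB SC|B C SB SC] /=.
  - by rewrite one_conj.
  - by rewrite add_conj /pgl_conj -scalemxAr -scalemxAl; exact: SD.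
  - by rewrite mul_conj; exact: SM.
by rewrite /pgl_conj !mulmxA mulmxV // mul1mx -mulmxA mulmxV // mulmx1.
Qed.

End Tuples.

(** * The closure of the image of a rational map *)

Section ImageVariety.
Variables (k : fieldType) (n : nat) (X : PGLvariety k n).
Hypothesis irrX : irreducible X.
Variables (m : nat) (e : 'I_m -> eqrmap X) (W : set X).
Local Notation V := {ffun 'I_m -> 'M[k]_n}.
Let F (x : X) : zariski V := [ffun i => mval (e i) x].
Hypotheses (oW : open W) (W0 : W !=set0).
Hypothesis We : forall x, W x -> forall i, rdom (e i) x.
Hypothesis Wgen : forall x, W x -> generating (F x).

Let Y : set (zariski V) := @generating k n m `&` closure (F @` W).

Let F_morphism x : W x -> morphism_at F x.
Proof.
move=> Wx; apply: tuple_morphism => i a b.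
apply: regular_at_ext (mval_regular (We Wx i) a b) => y.
by rewrite ffunE.
Qed.

Let YF x : W x -> Y (F x).
Proof. by move=> Wx; split; [exact: Wgen|apply: subset_closure; exists x]. Qed.

Let F_equivariant g x :
  W x -> W (gact g x) -> F (gact g x) = tuple_conj g (F x).
Proof.
move=> Wx Wgx; apply/ffunP => i; rewrite !ffunE.
by apply: mval_equivariant; exact: We.
Qed.

Let open_preimage (O : set (zariski V)) x : open O -> W x -> O (F x) ->
  exists U : set X, [/\ open U, U x, U `<=` W & forall y, U y -> O (F y)].
Proof.
move=> oO Wx OFx; have [cF _] := F_morphism Wx.
have : nbhs x [set y | W y /\ O (F y)].
  apply: filterI; first exact: open_nbhs_nbhs.
  have nO : nbhs (F x) O by exact: open_nbhs_nbhs.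
  exact: cF.
rewrite nbhsE => -[U [oU Ux] UP]; exists U; split=> // y /UP[] //.
Qed.

(* The image F(W) need not be stable, since W need not be. But W and its
   translate by the inverse of g meet every nonempty open set together, so
   each neighbourhood of a conjugate of a point of the closure meets F(W). *)
Let Y_stable g y : Y y -> Y (tuple_conj g y).
Proof.
move=> [gy cy]; split; first exact: generating_conj.
move=> B; rewrite nbhsE => -[O [oO Og] OB].
have nO : nbhs (tuple_conj g y : zariski V) O by exact: open_nbhs_nbhs.
have [cg _] := tuple_conj_morphism g (y : zariski V).
have : nbhs (y : zariski V) [set z | O (tuple_conj g z)] by exact: cg.
rewrite nbhsE => -[O' [oO' O'y] O'O].
have [_ [[x Wx <-] O'Fx]] := cy O' (open_nbhs_nbhs (conj oO' O'y)).
have [U [oU Ux UW UO]] := open_preimage oO' Wx O'Fx.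
have oW' : open (gact g @^-1` W : set X).
  by apply: open_comp => // z _; have [] := gact_morphism_l g z.
have [||z [Uz Wgz]] := ((irreducible_openP _).1 irrX).2 _ _ oU oW'.
- by exists x.
- have [w Ww] := W0; exists (gact (g^-1)%g w).
  by rewrite /preimage /= -gactM mulgV gact1.
have Wz := UW _ Uz; exists (F (gact g z)); split; first by exists (gact g z).
by rewrite F_equivariant //; apply/OB/O'O/UO.
Qed.

Lemma image_n_variety :
  exists (Y : set (zariski V)) (f : rmap X Y), [/\ n_variety Y, irreducible Y,
    equivariant (@tuple_conj k n m) (rdom f) (fun x => set_val (f x)),
    dominant f & rdom f = W /\ forall x, W x -> set_val (f x) = F x].
Proof.
have [x0 Wx0] := W0.
(* f is extended outside W by a constant, to be a total function to Y *)
pose p x := if x \in W then x else x0.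
have Wp x : W (p x) by rewrite /p; case: ifP => // /set_mem.
pose f x : Y := exist (fun y => y \in Y) (F (p x)) (mem_set (YF (Wp x))).
have fE x : W x -> set_val (f x) = F x.
  by move=> Wx; rewrite -[LHS]/(F (p x)) /p mem_set.
have mf x : W x -> morphism_at f x.
  move=> Wx; apply: morphism_at_set_type; apply: morphism_at_eq (F_morphism Wx).
  have nW : \forall y \near x, W y by exact: open_nbhs_nbhs.
  by apply: filterS nW => y Wy; rewrite fE.
have dW : dense W by exact: open_dense.
have hit (O : set Y) : open O -> O !=set0 -> exists2 x, W x & O (f x).
  move=> [O' oO' O'O] [y Oy].
  have O'y : O' (set_val y) by rewrite -[O' _]/((set_val @^-1` O') y) O'O.
  have [_ cy] : Y (set_val y) by exact: set_mem (valP y).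
  have [_ [[x Wx <-] O'Fx]] := cy O' (open_nbhs_nbhs (conj oO' O'y)).
  by exists x => //; rewrite -O'O /preimage /= -[X in O' X]/(set_val (f x)) fE.
exists Y, (RMap oW dW mf); split=> //.
- split; last exact: Y_stable.
  by exists (closure (F @` W)) => //; exact: closed_closure.
- apply/irreducible_openP; split; first by exists (f x0).
  move=> A B oA oB A0 B0.
  have [x Wx Ax] := hit A oA A0; have [y Wy By] := hit B oB B0.
  have pre (O : set Y) z : open O -> W z -> O (f z) ->
      exists U : set X, [/\ open U, U z & forall t, U t -> O (f t)].
    move=> [O' oO' O'O] Wz Oz.
    have [|U [oU Uz UW UO]] := @open_preimage O' z oO' Wz.
      by rewrite -fE // -[O' _]/((set_val @^-1` O') (f z)) O'O.
    exists U; split=> // t Ut; rewrite -O'O /preimage /=.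
    by rewrite -[X in O' X]/(set_val (f t)) fE; [exact: UO|exact: UW].
  have [U [oU Ux UA]] := pre A x oA Wx Ax.
  have [U' [oU' Uy UB]] := pre B y oB Wy By.
  have [||z [Uz U'z]] := ((irreducible_openP _).1 irrX).2 _ _ oU oU'.
  - by exists x.
  - by exists y.
  by exists (f z); split; [exact: UA|exact: UB].
- move=> g x Wx Wgx; rewrite -[LHS]/(set_val (f _)).
  by rewrite -[X in tuple_conj g X]/(set_val (f x)) !fE // F_equivariant.
- move=> O O0 oO; have [x Wx Ox] := hit O oO O0.
  by exists (f x); split=> //; exists x.
Qed.

End ImageVariety.

(** * Maps to n-varieties *)

Section Coordinates.
Variables (k : fieldType) (n : nat) (X : PGLvariety k n).

(** The components of f are equivariant rational maps, so their values at x lie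
    in the subalgebra of attained values. *)
Lemma generating_attained_values (m : nat)
    (Y : set (zariski {ffun 'I_m -> 'M[k]_n})) (f : rmap X Y) x :
  rdom f x -> n_variety Y ->
  equivariant (@tuple_conj k n m) (rdom f) (fun x => set_val (f x)) ->
  attained_values x = setT.
Proof.
move=> fx [[C _ YE] _] ef.
have YP y : Y y -> generating y by rewrite YE => -[].
apply: (YP (set_val (f x))); first exact: set_mem (valP (f x)).
  exact: attained_values_subalgebra.
move=> i.
have mphi y : rdom f y -> morphism_at (fun z => (set_val (f z) :
    {ffun 'I_m -> 'M[k]_n}) i : zariski 'M[k]_n) y.
  move=> fy; apply/morphism_matrixP.
  apply: (tuple_entries_regular (F := fun z => set_val (f z))).
  exact: morphism_at_comp (rfun_morphism fy) (@set_val_morphism _ _ _ _).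
have ephi : equivariant (@pgl_conj k n)
    (rdom (RMap (@rdom_open _ _ _ f) (@rdom_dense _ _ _ f) mphi))
    (fun z => (set_val (f z) : {ffun 'I_m -> 'M[k]_n}) i).
  by move=> g y fy fgy; rewrite ef // ffunE.
by exists (EqRMap ephi).
Qed.

End Coordinates.

Theorem mainTheorem6 (k : closedFieldType) (n : nat) (hn : (0 < n)%N)
    (X : PGLvariety k n) (irrX : irreducible X) :
  (central_simple_of_degree (RMaps X) n <->
   exists (m : nat) (Y : set (zariski {ffun 'I_m -> 'M[k]_n})) (f : rmap X Y),
     [/\ n_variety Y, irreducible Y,
         equivariant (@tuple_conj k n m) (rdom f) (fun x => set_val (f x)) &
         dominant f]) /\
  (central_simple_of_degree (RMaps X) n ->
   generically_free X /\
   exists (m : nat) (Y : set (zariski {ffun 'I_m -> 'M[k]_n})) (f : rmap X Y),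
     [/\ n_variety Y, irreducible Y,
         equivariant (@tuple_conj k n m) (rdom f) (fun x => set_val (f x)),
         dominant f & generically_injective f]).
Proof.
have embed : central_simple_of_degree (RMaps X) n ->
   generically_free X /\
   exists (m : nat) (Y : set (zariski {ffun 'I_m -> 'M[k]_n})) (f : rmap X Y),
     [/\ n_variety Y, irreducible Y,
         equivariant (@tuple_conj k n m) (rdom f) (fun x => set_val (f x)),
         dominant f & generically_injective f].
  move=> csa; have [e eu] := central_simple_generic_basis hn irrX csa.
  split; first exact: generic_basis_free eu.
  have [s [W [oW W0 Wdom es Winj]]] := generic_separation hn irrX eu.
  pose t (i : 'I_(size s)) := tnth (in_tuple s) i.
  have tE psi : psi \in s -> exists i, t i = psi.
    by move=> /(tnthP (in_tuple s))[i ->]; exists i.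
  have [||Y [f [nY iY ef df [fW fE]]]] := image_n_variety irrX (e := t) oW W0.
  - by move=> x /Wdom[_ sx] i; apply: sx; exact: mem_tnth.
  - move=> x Wx S algS St; have [[ex ux] _] := Wdom x Wx.
    apply: subalgebra_basis algS ux _ => i.
    have [|j tj] := tE (e i); first by apply: es; rewrite map_f // mem_enum.
    by have := St j; rewrite ffunE tj.
  exists (size s), Y, f; split=> //; exists W; split=> //.
  - exact: open_dense.
  - by rewrite fW.
  move=> x y Wx Wy fxy; apply: Winj => // psi /tE[i <-].
  have : set_val (f x) = set_val (f y) by rewrite fxy.
  by rewrite !fE // => /ffunP/(_ i); rewrite !ffunE.
split=> //; split=> [/embed[_ [m [Y [f [nY iY ef df _]]]]]|].
  by exists m, Y, f.
move=> [m [Y [f [nY _ ef _]]]]; have [[x _] _] := irrX.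
have [y [_ fy]] := @rdom_dense _ _ _ f setT (ex_intro _ x I) openT.
exact: (attained_values_central_simple hn irrX
  (generating_attained_values fy nY ef)).
Qed.
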